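(* $\mathsf{CD}^+$ does not prove any of the following sentences ($t$ ranging over codes of closed terms, $\varphi,\psi$ over codes of $\mathcal L_{\mathrm T}$-sentences, $\varphi(v)$ over codes of $\mathcal L_{\mathrm T}$-formulas with at most $v$ free): (i) $\forall t(\mathrm T\mathrm T\mathrm T t\to\mathrm T\mathrm T t)$; (ii) $\forall t(\mathrm T\mathrm T t\to\mathrm T\mathrm T\mathrm T t)$; (iii) $\forall\varphi(\mathrm T\mathrm T\varphi\leftrightarrow\mathrm T\mathrm T\neg\neg\varphi)$; (iv) $\forall\varphi,\psi(\mathrm T\mathrm T(\varphi\wedge\psi)\leftrightarrow\mathrm T\mathrm T\varphi\wedge\mathrm T\mathrm T\psi)$; (v) $\forall\varphi,\psi(\mathrm T\mathrm F(\varphi\wedge\psi)\leftrightarrow\mathrm T\mathrm F\varphi\vee\mathrm T\mathrm F\psi)$; (vi) $\forall\varphi(v)(\mathrm T\mathrm T(\forall v\varphi)\leftrightarrow\mathrm T(\forall t\,\mathrm T\varphi(t/v)))$; (vii) $\forall\varphi(v)(\mathrm T\mathrm F(\forall v\varphi)\leftrightarrow\mathrm T(\exists t\,\mathrm F\varphi(t/v)))$.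
   Context: **Language and notation.** $\mathcal L_{\mathbb N}$ is the language of arithmetic over $\{\bar 0,\mathrm S,+,\times\}$ with finitely many additional function symbols for elementary syntactic operations: $\mathrm{num}$ (sending $n$ to the code of its numeral) and functions sending codes of expressions to the codes of their negation, conjunction, universal quantification, and the code of a term $t$ to the codes of the atomic formulas $\mathrm T(t)$, $\mathrm D(t)$, etc. $\mathcal L_{\mathrm T}=\mathcal L_{\mathbb N}\cup\{\mathrm T\}$ and $\mathcal L_{\mathrm D}=\mathcal L_{\mathrm T}\cup\{\mathrm D\}$, with $\mathrm T,\mathrm D$ unary predicates. A Gödel numbering is fixed and expressions are identified with their codes. Logical primitives are $\neg,\wedge,\forall$, the others being defined. $s,t$ range over codes of closed terms and $t^\circ$ is the value of $t$; $\varphi(t/v)$ is substitution. Connectives and predicates inside $\mathrm T$ or $\mathrm D$ denote the corresponding syntactic operations on codes. $\mathrm F x:=\mathrm T(\neg x)$ (with $\neg$ the syntactic negation function). $\mathrm T\mathrm T\varphi$ and $\mathrm T\mathrm F\varphi$ are $\mathrm T$ applied to the code of $\mathrm T(\mathrm{num}(\varphi))$, resp. of $\mathrm F(\mathrm{num}(\varphi))$. For $t$ a closed term code, $\mathrm T\mathrm T t$, $\mathrm T\mathrm D t$ are $\mathrm T$ applied to the code of $\mathrm T(t)$, $\mathrm D(t)$ respectively (similarly $\mathrm D\mathrm T t$, $\mathrm D\mathrm D t$); $\mathrm T\mathrm T\mathrm T t$ is $\mathrm T\mathrm T\varphi$ for $\varphi$ the sentence $\mathrm T(t)$. In (vi),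 (vii), $\forall t\,\mathrm T\varphi(t/v)$ and $\exists t\,\mathrm F\varphi(t/v)$ under the outer $\mathrm T$ denote the code of the sentence ''for all closed terms $t$, $\mathrm T\varphi(t/v)$'', resp. ''for some closed term $t$, $\mathrm F\varphi(t/v)$''. **$\mathsf{CD}^+$** is the $\mathcal L_{\mathrm D}$-theory consisting of $\mathsf{PA}$ with induction for all $\mathcal L_{\mathrm D}$-formulas and the following axioms, in which $\varphi,\psi$ range over codes of $\mathcal L_{\mathrm D}$-sentences and $\varphi(v)$ over codes of $\mathcal L_{\mathrm D}$-formulas with at most $v$ free: - (T1) $\forall s\forall t(\mathrm T(s=t)\leftrightarrow s^\circ=t^\circ)$ - (T2$^+$) $\forall t(\mathrm D t^\circ\leftrightarrow \mathrm T\mathrm D t)$ - (T3) $\forall t(\mathrm D t^\circ\to(\mathrm T\mathrm T t\leftrightarrow \mathrm T t^\circ))$ - (T4) $\forall\varphi(\mathrm T(\neg\varphi)\leftrightarrow\neg\mathrm T\varphi)$ - (T5) $\forall\varphi,\psi(\mathrm T(\varphi\wedge\psi)\leftrightarrow \mathrm T\varphi\wedge\mathrm T\psi)$ - (T6) $\forall\varphi(v)(\mathrm T(\forall v\varphi)\leftrightarrow\forall t\,\mathrm T\varphi(t/v))$ - (D1) $\forall s\forall t\,\mathrm D(s=t)$ - (D2) $\forall t(\mathrm D\mathrm T t\leftrightarrow\mathrm D t^\circ)$ - (D3) $\forall t(\mathrm D\mathrm D t\leftrightarrow\mathrm D t^\circ)$ - (D4) $\forall\varphi(\mathrm D(\neg\varphi)\leftrightarrow\mathrm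 D\varphi)$ - (D5) $\forall\varphi,\psi\big(\mathrm D(\varphi\wedge\psi)\leftrightarrow((\mathrm D\varphi\wedge\mathrm D\psi)\vee(\mathrm D\varphi\wedge\mathrm T\neg\varphi)\vee(\mathrm D\psi\wedge\mathrm T\neg\psi))\big)$ - (D6) $\forall\varphi(v)\big(\mathrm D(\forall v\varphi)\leftrightarrow(\forall t\,\mathrm D\varphi(t/v)\vee\exists t(\mathrm D\varphi(t/v)\wedge\mathrm T\neg\varphi(t/v)))\big)$ - (R1) $\forall\varphi(v)\forall s\forall t(s^\circ=t^\circ\to(\mathrm T\varphi(s)\leftrightarrow\mathrm T\varphi(t)))$ - (R2) $\forall\varphi(v)\forall s\forall t(s^\circ=t^\circ\to(\mathrm D\varphi(s)\leftrightarrow\mathrm D\varphi(t)))$ *)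

(* Defs.v *)
From mathcomp Require Import all_boot.

Set Implicit Arguments.
Unset Strict Implicit.
Unset Printing Implicit Defensive.

(* Besides 0, S, + and *, the language of arithmetic has the function symbols
     Num    x |-> the code of the numeral of x
     NegF   code of A |-> code of ~A
     TrF    code of t |-> code of T(t)
     DetF   code of t |-> code of D(t)
     EqF    codes of s, t |-> code of s = t
     ConjF  codes of A, B |-> code of A /\ B
     AllF   codes of v, A |-> code of (forall v, A)   (v a variable)
     tSub   codes of A, t, v |-> code of A(t/v)       (v a variable) *)
Inductive fun1 := Succ | Num | NegF | TrF | DetF.
Inductive fun2 := Add | Mul | EqF | ConjF | AllF.

Inductive term :=
  | tVar of nat
  | tZero
  | tFun1 of fun1 & term
  | tFun2 of fun2 & term & term
  | tSub of term & term & term.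

Inductive form :=
  | fEq of term & term
  | fTr of term
  | fDet of term
  | fNeg of form
  | fConj of form & form
  | fAll of nat & form.

Definition fImp (A B : form) : form := fNeg (fConj A (fNeg B)).

Fixpoint occurs (x : nat) (t : term) : bool :=
  match t with
  | tVar y => x == y
  | tZero => false
  | tFun1 _ t1 => occurs x t1
  | tFun2 _ t1 t2 => occurs x t1 || occurs x t2
  | tSub t1 t2 t3 => [|| occurs x t1, occurs x t2 | occurs x t3]
  end.

Fixpoint free (x : nat) (A : form) : bool :=
  match A with
  | fEq s t => occurs x s || occurs x t
  | fTr t => occurs x t
  | fDet t => occurs x t
  | fNeg B => free x B
  | fConj B C => free x B || free x C
  | fAll y B => (x != y) && free x B
  end.

Fixpoint substt (x : nat) (s : term) (t : term) : term :=
  match t with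
  | tVar y => if x == y then s else tVar y
  | tZero => tZero
  | tFun1 f t1 => tFun1 f (substt x s t1)
  | tFun2 f t1 t2 => tFun2 f (substt x s t1) (substt x s t2)
  | tSub t1 t2 t3 => tSub (substt x s t1) (substt x s t2) (substt x s t3)
  end.

(* Bound variables are not renamed; see [freefor]. *)
Fixpoint subst (x : nat) (s : term) (A : form) : form :=
  match A with
  | fEq t u => fEq (substt x s t) (substt x s u)
  | fTr t => fTr (substt x s t)
  | fDet t => fDet (substt x s t)
  | fNeg B => fNeg (subst x s B)
  | fConj B C => fConj (subst x s B) (subst x s C)
  | fAll y B => if x == y then fAll y B else fAll y (subst x s B)
  end.

(* No free occurrence of x in A lies in the scope of a quantifier that would
   capture a variable of s. *)
Fixpoint freefor (x : nat) (s : term) (A : form) : bool :=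
  match A with
  | fEq _ _ | fTr _ | fDet _ => true
  | fNeg B => freefor x s B
  | fConj B C => freefor x s B && freefor x s C
  | fAll y B => ~~ free x (fAll y B) || (~~ occurs y s && freefor x s B)
  end.

Definition tautology (A : form) : Prop :=
  forall v : form -> bool,
    (forall B, v (fNeg B) = ~~ v B) ->
    (forall B C, v (fConj B C) = v B && v C) ->
    v A.

(* A Hilbert calculus.  Generalisation is unrestricted, so a non-logical axiom
   with free variables has the force of its universal closure. *)
Inductive derivable (Th : form -> Prop) : form -> Prop :=
  | d_axiom A : Th A -> derivable Th A
  | d_taut A : tautology A -> derivable Th A
  | d_inst x t A : freefor x t A ->
      derivable Th (fImp (fAll x A) (subst x t A))
  | d_dist x A B : ~~ free x A ->
      derivable Th (fImp (fAll x (fImp A B)) (fImp A (fAll x B)))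
  | d_refl t : derivable Th (fEq t t)
  | d_leibniz x s t A : freefor x s A -> freefor x t A ->
      derivable Th (fImp (fEq s t) (fImp (subst x s A) (subst x t A)))
  | d_mp A B : derivable Th (fImp A B) -> derivable Th A -> derivable Th B
  | d_gen x A : derivable Th A -> derivable Th (fAll x A).

(* Injective because (a + b)^2 <= pr a b < (a + b + 1)^2.  It is a polynomial,
   hence expressible by a term of the language: see [tpr]. *)
Definition pr (a b : nat) : nat := (a + b) * (a + b) + a.

Definition tagVar := 1.
Definition tagZero := 2.
Definition tag1 (f : fun1) : nat :=
  match f with Succ => 3 | Num => 4 | NegF => 5 | TrF => 6 | DetF => 7 end.
Definition tag2 (f : fun2) : nat :=
  match f with Add => 8 | Mul => 9 | EqF => 10 | ConjF => 11 | AllF => 12 end.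
Definition tagSub := 13.
Definition tagEq := 14.
Definition tagTr := 15.
Definition tagDet := 16.
Definition tagNeg := 17.
Definition tagConj := 18.
Definition tagAll := 19.

Fixpoint codet (t : term) : nat :=
  match t with
  | tVar i => pr tagVar i
  | tZero => pr tagZero 0
  | tFun1 f t1 => pr (tag1 f) (codet t1)
  | tFun2 f t1 t2 => pr (tag2 f) (pr (codet t1) (codet t2))
  | tSub t1 t2 t3 => pr tagSub (pr (codet t1) (pr (codet t2) (codet t3)))
  end.

Fixpoint code (A : form) : nat :=
  match A with
  | fEq s t => pr tagEq (pr (codet s) (codet t))
  | fTr t => pr tagTr (codet t)
  | fDet t => pr tagDet (codet t)
  | fNeg B => pr tagNeg (code B)
  | fConj B C => pr tagConj (pr (code B) (code C))
  | fAll x B => pr tagAll (pr (codet (tVar x)) (code B))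
  end.

Definition numeral (n : nat) : term := iter n (tFun1 Succ) tZero.

(* Codes of formulas are astronomically large in unary. *)
Arguments codet : simpl never.
Arguments code : simpl never.
Arguments numeral : simpl never.

Definition tpr (s t : term) : term :=
  tFun2 Add (tFun2 Mul (tFun2 Add s t) (tFun2 Add s t)) s.

(* If the values of the arguments are codes of terms, the value of the result
   is the code of the term built from them by the indicated constructor. *)
Definition cVar (i : term) : term := tpr (numeral tagVar) i.
Definition cZero : term := tpr (numeral tagZero) tZero.
Definition cFun1 (f : fun1) (x : term) : term := tpr (numeral (tag1 f)) x.
Definition cFun2 (f : fun2) (x y : term) : term :=
  tpr (numeral (tag2 f)) (tpr x y).
Definition cSub (x y z : term) : term :=
  tpr (numeral tagSub) (tpr x (tpr y z)).

(* An element of [pform] is a formula waiting for a level k such that its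
   parameters only involve variables of index < k; its bound variables are then
   taken among those of index >= k.  In particular [P 0] is a sentence if P has
   no parameters. *)
Definition pform := nat -> form.

Definition pEq (s t : term) : pform := fun _ => fEq s t.
Definition pTr (t : term) : pform := fun _ => fTr t.
Definition pDet (t : term) : pform := fun _ => fDet t.
Definition pNeg (P : pform) : pform := fun k => fNeg (P k).
Definition pConj (P Q : pform) : pform := fun k => fConj (P k) (Q k).
Definition pAll (P : term -> pform) : pform :=
  fun k => fAll k (P (tVar k) k.+1).

Definition pImp (P Q : pform) : pform := pNeg (pConj P (pNeg Q)).
Definition pOr (P Q : pform) : pform := pNeg (pConj (pNeg P) (pNeg Q)).
Definition pIff (P Q : pform) : pform := pConj (pImp P Q) (pImp Q P).
Definition pEx (P : term -> pform) : pform := pNeg (pAll (fun x => pNeg (P x))).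
Definition pFalse : pform := pNeg (pEq tZero tZero).

Definition pAllIn (S P : term -> pform) : pform :=
  pAll (fun x => pImp (S x) (P x)).
Definition pExIn (S P : term -> pform) : pform :=
  pEx (fun x => pConj (S x) (P x)).

Declare Scope pform_scope.
Delimit Scope pform_scope with pf.
Bind Scope pform_scope with pform.

Notation "s ≐ t" := (pEq s t) (at level 70, no associativity) : pform_scope.
Notation "¬ P" := (pNeg P) (at level 75, right associativity) : pform_scope.
Notation "P ∧ Q" := (pConj P Q) (at level 80, right associativity) : pform_scope.
Notation "P ∨ Q" := (pOr P Q) (at level 85, right associativity) : pform_scope.
Notation "P ⇒ Q" := (pImp P Q) (at level 90, right associativity) : pform_scope.
Notation "P ⇔ Q" := (pIff P Q) (at level 95, no associativity) : pform_scope.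
Notation "∀ x , P" := (pAll (fun x => P%pf))
  (at level 200, x name, P at level 200) : pform_scope.
Notation "∃ x , P" := (pEx (fun x => P%pf))
  (at level 200, x name, P at level 200) : pform_scope.
Notation "∀ x ∈ S , P" := (pAllIn S (fun x => P%pf))
  (at level 200, x name, S at level 99, P at level 200) : pform_scope.
Notation "∃ x ∈ S , P" := (pExIn S (fun x => P%pf))
  (at level 200, x name, S at level 99, P at level 200) : pform_scope.
Local Open Scope pform_scope.

Definition pOrs (I : Type) (s : seq I) (P : I -> pform) : pform :=
  foldr (fun i Q => P i ∨ Q) pFalse s.

Definition fun1s : seq fun1 := [:: Succ; Num; NegF; TrF; DetF].
Definition fun2s : seq fun2 := [:: Add; Mul; EqF; ConjF; AllF].

Definition pLt (s t : term) : pform := ∃ w, tFun2 Add (tFun1 Succ w) s ≐ t.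

(* Goedel's beta function: z is the remainder of a modulo 1 + (i + 1) * b. *)
Definition pBeta (a b i z : term) : pform :=
  let m := tFun1 Succ (tFun2 Mul (tFun1 Succ i) b) in
  ∃ q, a ≐ tFun2 Add (tFun2 Mul q m) z ∧ pLt z m.

(* x is the last entry of a finite sequence each entry z of which satisfies
   [step prev z], where [prev] holds of the earlier entries: x belongs to the
   set inductively generated by [step]. *)
Definition pInd (step : (term -> pform) -> term -> pform) (x : term) : pform :=
  ∃ a, ∃ b, ∃ n,
    pBeta a b n x ∧
    ∀ i, pLt i (tFun1 Succ n) ⇒
    ∀ z, pBeta a b i z ⇒ step (fun y => ∃ j, pLt j i ∧ pBeta a b j y) z.

Definition pVar (x : term) : pform := ∃ i, x ≐ cVar i.

(* Terms all of whose variables satisfy V. *)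
Definition pTermOver (V : term -> pform) : term -> pform :=
  pInd (fun prev z =>
    (pVar z ∧ V z)
    ∨ z ≐ cZero
    ∨ pOrs fun1s (fun f => ∃ x, prev x ∧ z ≐ cFun1 f x)
    ∨ pOrs fun2s (fun f => ∃ x, ∃ y, prev x ∧ prev y ∧ z ≐ cFun2 f x y)
    ∨ (∃ x, ∃ y, ∃ w, prev x ∧ prev y ∧ prev w ∧ z ≐ cSub x y w)).

Definition pTerm : term -> pform := pTermOver (fun _ => ¬ pFalse).
Definition pClTerm : term -> pform := pTermOver (fun _ => pFalse).
Definition pAvoid (u : term) : term -> pform := pTermOver (fun z => ¬ (z ≐ u)).

Variant lang := LT | LD.

(* [At] is the condition on the terms in atomic formulas, [Q prev v x] the
   condition under which (forall v, x) is generated. *)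
Definition pFormStep (L : lang) (At : term -> pform)
    (Q : (term -> pform) -> term -> term -> pform)
    (prev : term -> pform) (z : term) : pform :=
  (∃ x, ∃ y, At x ∧ At y ∧ z ≐ tFun2 EqF x y)
  ∨ (∃ x, At x ∧ z ≐ tFun1 TrF x)
  ∨ (if L is LD then ∃ x, At x ∧ z ≐ tFun1 DetF x else pFalse)
  ∨ (∃ x, prev x ∧ z ≐ tFun1 NegF x)
  ∨ (∃ x, ∃ y, prev x ∧ prev y ∧ z ≐ tFun2 ConjF x y)
  ∨ (∃ v, ∃ x, pVar v ∧ Q prev v x ∧ z ≐ tFun2 AllF v x).

Definition pForm (L : lang) : term -> pform :=
  pInd (pFormStep L pTerm (fun prev _ x => prev x)).

Definition pNotFree (u : term) : term -> pform :=
  pInd (pFormStep LD (pAvoid u)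
          (fun prev v x => (v ≐ u ∧ pForm LD x) ∨ prev x)).

Definition pSent (L : lang) (x : term) : pform :=
  pForm L x ∧ ∀ u ∈ pVar, pNotFree u x.

(* x is a formula with at most the variable v free. *)
Definition pForm1 (L : lang) (v x : term) : pform :=
  pForm L x ∧ ∀ u ∈ pVar, ¬ (u ≐ v) ⇒ pNotFree u x.

(* y is the value of the closed term t; generated pairs are <term, value>. *)
Definition pVal (t y : term) : pform :=
  pInd (fun prev z =>
    z ≐ tpr cZero tZero
    ∨ pOrs fun1s (fun f => ∃ x1, ∃ y1,
        prev (tpr x1 y1) ∧ z ≐ tpr (cFun1 f x1) (tFun1 f y1))
    ∨ pOrs fun2s (fun f => ∃ x1, ∃ y1, ∃ x2, ∃ y2,
        prev (tpr x1 y1) ∧ prev (tpr x2 y2) ∧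
        z ≐ tpr (cFun2 f x1 x2) (tFun2 f y1 y2))
    ∨ (∃ x1, ∃ y1, ∃ x2, ∃ y2, ∃ x3, ∃ y3,
        prev (tpr x1 y1) ∧ prev (tpr x2 y2) ∧ prev (tpr x3 y3) ∧
        z ≐ tpr (cSub x1 x2 x3) (tSub y1 y2 y3))) (tpr t y).

(* s° = t°, T t° and D t°: the value of a closed term is given by a formula, not
   by a function symbol. *)
Definition pEqVal (s t : term) : pform := ∃ y, pVal s y ∧ pVal t y.
Definition pTrVal (t : term) : pform := ∃ y, pVal t y ∧ pTr y.
Definition pDetVal (t : term) : pform := ∃ y, pVal t y ∧ pDet y.

(* The second and third groups are the defining equations of the additional
   function symbols; those of tSub proceed by recursion on the coded
   expression, and leave numbers that are not coded expressions unchanged. *)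
Inductive PA_axiom : form -> Prop :=
  | PA_succ0 : PA_axiom ((∀ x, ¬ (tFun1 Succ x ≐ tZero)) 0)
  | PA_succI : PA_axiom
      ((∀ x, ∀ y, tFun1 Succ x ≐ tFun1 Succ y ⇒ x ≐ y) 0)
  | PA_add0 : PA_axiom ((∀ x, tFun2 Add x tZero ≐ x) 0)
  | PA_addS : PA_axiom
      ((∀ x, ∀ y, tFun2 Add x (tFun1 Succ y) ≐ tFun1 Succ (tFun2 Add x y)) 0)
  | PA_mul0 : PA_axiom ((∀ x, tFun2 Mul x tZero ≐ tZero) 0)
  | PA_mulS : PA_axiom
      ((∀ x, ∀ y,
         tFun2 Mul x (tFun1 Succ y) ≐ tFun2 Add (tFun2 Mul x y) x) 0)
  | PA_induction x A : PA_axiom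
      (fImp (fConj (subst x tZero A)
                   (fAll x (fImp A (subst x (tFun1 Succ (tVar x)) A))))
            (fAll x A))

  | PA_num0 : PA_axiom ((tFun1 Num tZero ≐ cZero) 0)
  | PA_numS : PA_axiom
      ((∀ x, tFun1 Num (tFun1 Succ x) ≐ cFun1 Succ (tFun1 Num x)) 0)
  | PA_neg : PA_axiom ((∀ x, tFun1 NegF x ≐ tpr (numeral tagNeg) x) 0)
  | PA_tr : PA_axiom ((∀ x, tFun1 TrF x ≐ tpr (numeral tagTr) x) 0)
  | PA_det : PA_axiom ((∀ x, tFun1 DetF x ≐ tpr (numeral tagDet) x) 0)
  | PA_eq : PA_axiom
      ((∀ x, ∀ y, tFun2 EqF x y ≐ tpr (numeral tagEq) (tpr x y)) 0)
  | PA_conj : PA_axiom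
      ((∀ x, ∀ y, tFun2 ConjF x y ≐ tpr (numeral tagConj) (tpr x y)) 0)
  | PA_all : PA_axiom
      ((∀ x, ∀ y, tFun2 AllF x y ≐ tpr (numeral tagAll) (tpr x y)) 0)

  | PA_sub_var_eq : PA_axiom
      ((∀ t, ∀ i, tSub (cVar i) t (cVar i) ≐ t) 0)
  | PA_sub_var_neq : PA_axiom
      ((∀ t, ∀ v, ∀ i, ¬ (cVar i ≐ v) ⇒ tSub (cVar i) t v ≐ cVar i) 0)
  | PA_sub_zero : PA_axiom ((∀ t, ∀ v, tSub cZero t v ≐ cZero) 0)
  | PA_sub_fun1 f : PA_axiom
      ((∀ t, ∀ v, ∀ x, tSub (cFun1 f x) t v ≐ cFun1 f (tSub x t v)) 0)
  | PA_sub_fun2 f : PA_axiom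
      ((∀ t, ∀ v, ∀ x, ∀ y,
         tSub (cFun2 f x y) t v ≐ cFun2 f (tSub x t v) (tSub y t v)) 0)
  | PA_sub_sub : PA_axiom
      ((∀ t, ∀ v, ∀ x, ∀ y, ∀ z,
         tSub (cSub x y z) t v
         ≐ cSub (tSub x t v) (tSub y t v) (tSub z t v)) 0)
  | PA_sub_eq : PA_axiom
      ((∀ t, ∀ v, ∀ x, ∀ y,
         tSub (tFun2 EqF x y) t v ≐ tFun2 EqF (tSub x t v) (tSub y t v)) 0)
  | PA_sub_tr : PA_axiom
      ((∀ t, ∀ v, ∀ x, tSub (tFun1 TrF x) t v ≐ tFun1 TrF (tSub x t v)) 0)
  | PA_sub_det : PA_axiom
      ((∀ t, ∀ v, ∀ x, tSub (tFun1 DetF x) t v ≐ tFun1 DetF (tSub x t v)) 0)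
  | PA_sub_neg : PA_axiom
      ((∀ t, ∀ v, ∀ x, tSub (tFun1 NegF x) t v ≐ tFun1 NegF (tSub x t v)) 0)
  | PA_sub_conj : PA_axiom
      ((∀ t, ∀ v, ∀ x, ∀ y,
         tSub (tFun2 ConjF x y) t v
         ≐ tFun2 ConjF (tSub x t v) (tSub y t v)) 0)
  | PA_sub_all_eq : PA_axiom
      ((∀ t, ∀ v, ∀ x, tSub (tFun2 AllF v x) t v ≐ tFun2 AllF v x) 0)
  | PA_sub_all_neq : PA_axiom
      ((∀ t, ∀ v, ∀ u, ∀ x, ¬ (u ≐ v) ⇒
         tSub (tFun2 AllF u x) t v ≐ tFun2 AllF u (tSub x t v)) 0)
  | PA_sub_other : PA_axiom
      ((∀ t, ∀ v, ∀ z,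
         ¬ (pVar z
            ∨ z ≐ cZero
            ∨ pOrs fun1s (fun f => ∃ x, z ≐ cFun1 f x)
            ∨ pOrs fun2s (fun f => ∃ x, ∃ y, z ≐ cFun2 f x y)
            ∨ (∃ x, ∃ y, ∃ w, z ≐ cSub x y w)
            ∨ pOrs [:: TrF; DetF; NegF] (fun f => ∃ x, z ≐ tFun1 f x)
            ∨ pOrs [:: EqF; ConjF; AllF]
                (fun f => ∃ x, ∃ y, z ≐ tFun2 f x y)) ⇒
         tSub z t v ≐ z) 0).

Inductive CDplus : form -> Prop :=
  | CD_PA A : PA_axiom A -> CDplus A
  | CD_T1 : CDplus
      ((∀ s ∈ pClTerm, ∀ t ∈ pClTerm, pTr (tFun2 EqF s t) ⇔ pEqVal s t) 0)
  | CD_T2plus : CDplus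
      ((∀ t ∈ pClTerm, pDetVal t ⇔ pTr (tFun1 DetF t)) 0)
  | CD_T3 : CDplus
      ((∀ t ∈ pClTerm, pDetVal t ⇒ (pTr (tFun1 TrF t) ⇔ pTrVal t)) 0)
  | CD_T4 : CDplus
      ((∀ x ∈ pSent LD, pTr (tFun1 NegF x) ⇔ ¬ pTr x) 0)
  | CD_T5 : CDplus
      ((∀ x ∈ pSent LD, ∀ y ∈ pSent LD,
         pTr (tFun2 ConjF x y) ⇔ (pTr x ∧ pTr y)) 0)
  | CD_T6 : CDplus
      ((∀ v ∈ pVar, ∀ x ∈ pForm1 LD v,
         pTr (tFun2 AllF v x) ⇔ (∀ t ∈ pClTerm, pTr (tSub x t v))) 0)
  | CD_D1 : CDplus
      ((∀ s ∈ pClTerm, ∀ t ∈ pClTerm, pDet (tFun2 EqF s t)) 0)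
  | CD_D2 : CDplus
      ((∀ t ∈ pClTerm, pDet (tFun1 TrF t) ⇔ pDetVal t) 0)
  | CD_D3 : CDplus
      ((∀ t ∈ pClTerm, pDet (tFun1 DetF t) ⇔ pDetVal t) 0)
  | CD_D4 : CDplus
      ((∀ x ∈ pSent LD, pDet (tFun1 NegF x) ⇔ pDet x) 0)
  | CD_D5 : CDplus
      ((∀ x ∈ pSent LD, ∀ y ∈ pSent LD,
         pDet (tFun2 ConjF x y) ⇔
         ((pDet x ∧ pDet y)
          ∨ (pDet x ∧ pTr (tFun1 NegF x))
          ∨ (pDet y ∧ pTr (tFun1 NegF y)))) 0)
  | CD_D6 : CDplus
      ((∀ v ∈ pVar, ∀ x ∈ pForm1 LD v,
         pDet (tFun2 AllF v x) ⇔
         ((∀ t ∈ pClTerm, pDet (tSub x t v))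
          ∨ (∃ t ∈ pClTerm,
               pDet (tSub x t v) ∧ pTr (tFun1 NegF (tSub x t v))))) 0)
  | CD_R1 : CDplus
      ((∀ v ∈ pVar, ∀ x ∈ pForm1 LD v, ∀ s ∈ pClTerm, ∀ t ∈ pClTerm,
         pEqVal s t ⇒ (pTr (tSub x s v) ⇔ pTr (tSub x t v))) 0)
  | CD_R2 : CDplus
      ((∀ v ∈ pVar, ∀ x ∈ pForm1 LD v, ∀ s ∈ pClTerm, ∀ t ∈ pClTerm,
         pEqVal s t ⇒ (pDet (tSub x s v) ⇔ pDet (tSub x t v))) 0).

(* The code of T(num(x)). *)
Definition trNum (x : term) : term := tFun1 TrF (tFun1 Num x).

(* The code of F(num(x)), that is of T(~ num(x)): the negation symbol stays
   inside as a function symbol applied to the numeral of x. *)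
Definition faNum (x : term) : term := tFun1 TrF (cFun1 NegF (tFun1 Num x)).

(* TTt and TTTt take the code of a closed term, TTs and TFs the code of
   a sentence. *)
Definition TTt (t : term) : pform := pTr (tFun1 TrF t).
Definition TTTt (t : term) : pform := pTr (trNum (tFun1 TrF t)).

Definition TTs (x : term) : pform := pTr (trNum x).
Definition TFs (x : term) : pform := pTr (faNum x).

Definition cClTerm0 : term := numeral (code (pClTerm (tVar 0) 1)).

(* The code of the term sub(num(x), v_0, num(v)): it denotes x(t/v) when v_0
   is assigned t. *)
Definition cSub0 (x v : term) : term :=
  cSub (tFun1 Num x) (cVar tZero) (tFun1 Num v).

(* The code of the sentence "for all closed terms t, T x(t/v)". *)
Definition allTrInst (x v : term) : term :=
  tFun2 AllF (cVar tZero)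
    (tFun1 NegF (tFun2 ConjF cClTerm0
                   (tFun1 NegF (tFun1 TrF (cSub0 x v))))).

(* The code of the sentence "for some closed term t, F x(t/v)". *)
Definition exFaInst (x v : term) : term :=
  tFun1 NegF (tFun2 AllF (cVar tZero)
    (tFun1 NegF (tFun2 ConjF cClTerm0
                   (tFun1 TrF (cFun1 NegF (cSub0 x v)))))).

(* Main.v *)
From mathcomp Require Import all_boot.
From mathcomp Require Import boolp zify.
Require Import Defs.

(** The theory is sound for a family of models over the standard natural numbers.
    Let D be the set of sentences that receive a value in the least fixed point of
    strong Kleene evaluation, in the manner of Kripke, where T(t) takes the value of
    the sentence coded by t, and D(t) takes the value true as soon as that sentence
    has a value ([detval], [det]); other formulas are treated as sentences by
    reading their free variables as 0.  Let X be any set of numbers that contains all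
    determinately true sentences and no determinately false one.  Interpret D by
    this set, and T by the set of sentences true in the standard model when the
    T inside them is read as X and the D inside them as D ([truth]).  Then all
    axioms hold ([CDplus_sound]).

    So outside D nothing constrains X, and the sentences of the theorem, which
    speak about X by means of two layers of T, can be refuted by choosing it.  No
    diagonalisation is necessary for finding something undetermined: 0 is not the
    code of a sentence, so T(0) is undetermined, as are its compounds such as
    T(0) /\ T(0) and forall v, T(0).  In each case X is the set of determinately
    true sentences with a single undetermined number added ([addTrue]): 0 itself
    for (ii), the code of ~ (T(0) /\ T(0)) for (v), that of ~ forall v, T(0) for
    (vii), and that of T(0) for the others.

    The bulk of the work is to read the arithmetised syntax in the standard model:
    inductive definitions are coded by Goedel's beta function, for which
    [beta_seq] provides codes of all finite sequences, and formulas are given as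
    functions of a level from which bound variables are chosen, whose meaning is
    computed compositionally ([den], [den_tac]). *)

Set Implicit Arguments.
Unset Strict Implicit.
Unset Printing Implicit Defensive.

Local Open Scope pform_scope.

(** * Codes *)

Lemma pr_inj a b c d : pr a b = pr c d -> a = c /\ b = d.
Proof.
rewrite /pr => E.
have Es : a + b = c + d by nia.
move: E; rewrite Es; lia.
Qed.

Lemma ltn_pr2 a b : 0 < a -> b < pr a b.
Proof. rewrite /pr; nia. Qed.

Lemma leq_pr1 a b : a <= pr a b.
Proof. exact: leq_addl. Qed.

Lemma leq_pr2 a b : b <= pr a b.
Proof. rewrite /pr; nia. Qed.

Lemma tag1_inj : injective tag1.
Proof. by case; case. Qed.

Lemma tag2_inj : injective tag2.
Proof. by case; case. Qed.

Lemma codet_inj : injective codet.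
Proof.
elim=> [i||f t IH|f t1 IH1 t2 IH2|t1 IH1 t2 IH2 t3 IH3]
  [j||g u|g u1 u2|u1 u2 u3] /pr_inj [];
  try solve [by [] | by case: f | by case: g | by case: f; case: g].
- by move=> _ ->.
- by move=> /tag1_inj -> /IH ->.
- by move=> /tag2_inj -> /pr_inj [/IH1 -> /IH2 ->].
- by move=> _ /pr_inj [/IH1 -> /pr_inj [/IH2 -> /IH3 ->]].
Qed.

Lemma code_inj : injective code.
Proof.
elim=> [s t|t|t|A IH|A IHA B IHB|x A IH] [s' t'|t'|t'|A'|A' B'|x' A'] /pr_inj [] //.
- by move=> _ /pr_inj [/codet_inj -> /codet_inj ->].
- by move=> _ /codet_inj ->.
- by move=> _ /codet_inj ->.
- by move=> _ /IH ->.
- by move=> _ /pr_inj [/IHA -> /IHB ->].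
- by move=> _ /pr_inj [/codet_inj [->] /IH ->].
Qed.

Lemma code_gt0 A : 0 < code A.
Proof. by case: A => *; apply: leq_trans (leq_pr1 _ _). Qed.

(** * The beta function *)

(** The number whose graph is [pBeta]. *)
Definition beta (a b i : nat) : nat := a %% (i.+1 * b).+1.

(** A common divisor of both moduli is prime to b and divides their difference
    (j - i) * b, hence divides j - i, and so b. *)
Lemma beta_modulus_coprime b i j :
  i < j -> (j - i) %| b -> coprime (i.+1 * b).+1 (j.+1 * b).+1.
Proof.
move=> lij dvd.
have cb k : coprime (k.+1 * b).+1 b.
  by rewrite coprime_sym -addn1 /coprime gcdnMDl gcdn1.
have E : (j.+1 * b).+1 = (j - i) * b + (i.+1 * b).+1.
  by rewrite addnS -mulnDl; congr (_ * _).+1; lia.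
rewrite E /coprime gcdnDr -/(coprime _ _) coprimeMr cb andbT.
exact: coprime_dvdr dvd (cb i).
Qed.

Lemma chinese_remainder_seq (m r : nat -> nat) n :
  (forall i j, i < j < n -> coprime (m i) (m j)) ->
  exists a, forall i, i < n -> a = r i %[mod m i].
Proof.
elim: n => [|n IHn] co; first by exists 0.
case: IHn => [i j /andP[lij ljn]|a Ha]; first by apply: co; lia.
have co_n : coprime (\prod_(i < n) m i) (m n).
  elim/big_ind: _ => [|x y cx cy|i _]; first exact: coprime1n.
    by rewrite coprimeMl cx.
  by apply: co; rewrite ltn_ord /=.
exists (chinese (\prod_(i < n) m i) (m n) a (r n)) => i.
rewrite ltnS leq_eqVlt => /orP[/eqP -> | lt_in]; first exact: chinese_modr.
have dvd_m : m i %| \prod_(j < n) m j.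
  by rewrite (bigD1 (Ordinal lt_in)) //= dvdn_mulr.
by rewrite -Ha // -(modn_dvdm _ dvd_m) chinese_modl // modn_dvdm.
Qed.

(** With b the factorial of a bound for the length and for all entries, the
    moduli are pairwise coprime and exceed the entries. *)
Lemma beta_seq (s : seq nat) :
  exists a b, forall i, i < size s -> beta a b i = nth 0 s i.
Proof.
pose b := (maxn (size s) (\max_(x <- s) x))`!.
have b_gt i : i < size s -> nth 0 s i < (i.+1 * b).+1.
  move=> lis; rewrite ltnS.
  have : nth 0 s i <= b.
    apply: leq_trans (fact_geq _); rewrite leq_max; apply/orP; right.
    by apply: (leq_bigmax_seq _ (mem_nth 0 lis)).
  by move=> h; apply: leq_trans h _; rewrite mulSn leq_addr.
case: (@chinese_remainder_seq (fun i => (i.+1 * b).+1) (nth 0 s) (size s)).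
  move=> i j /andP[lij ljs]; apply: beta_modulus_coprime => //.
  apply: dvdn_fact; rewrite subn_gt0 lij /=.
  by apply: leq_trans (leq_subr _ _) _; apply: leq_trans (ltnW ljs) (leq_maxl _ _).
move=> a Ha; exists a, b => i lis; rewrite /beta Ha // modn_small //; exact: b_gt.
Qed.

(** * Substitution on codes *)

(** Any inverse of [pr] would do; the search is over pairs of components at most
    z because both components of a pair are at most its code. *)
Definition unpair (z : nat) : option (nat * nat) :=
  omap (fun p : 'I_z.+1 * 'I_z.+1 => (p.1 : nat, p.2 : nat))
       [pick p : 'I_z.+1 * 'I_z.+1 | pr p.1 p.2 == z].

Lemma unpair_some z a b : unpair z = Some (a, b) -> z = pr a b.
Proof. by rewrite /unpair; case: pickP => //= p /eqP E [<- <-]. Qed.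

Lemma unpairK a b : unpair (pr a b) = Some (a, b).
Proof.
rewrite /unpair; case: pickP => [p /eqP /pr_inj [/= -> ->] // | no].
have ha : a < (pr a b).+1 by rewrite ltnS leq_pr1.
have hb : b < (pr a b).+1 by rewrite ltnS leq_pr2.
by have := no (Ordinal ha, Ordinal hb); rewrite /= eqxx.
Qed.

(* Prevents unification from computing with codes. *)
#[local] Opaque pr unpair.

(** Unary and binary constructors of terms and of formulas, with which substitution
    commutes. *)
Definition unary_tags : seq nat := map tag1 fun1s ++ [:: tagTr; tagDet; tagNeg].
Definition binary_tags : seq nat := map tag2 fun2s ++ [:: tagEq; tagConj].

(** The axioms for [tSub] recurse on arbitrary numbers, read as trees through
    [pr], and not only on codes of expressions; k bounds the depth of the
    recursion. *)
Fixpoint subst_fuel (k t v z : nat) : nat :=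
  if k isn't k'.+1 then z else
  if unpair z isn't Some (g, x) then z else
  if g == tagVar then if z == v then t else z else
  if g \in unary_tags then pr g (subst_fuel k' t v x) else
  if unpair x isn't Some (y, w) then z else
  if g \in binary_tags then
    pr g (pr (subst_fuel k' t v y) (subst_fuel k' t v w)) else
  if g == tagAll then
    pr g (pr y (if y == v then w else subst_fuel k' t v w)) else
  if g != tagSub then z else
  if unpair w isn't Some (p, q) then z else
  pr g (pr (subst_fuel k' t v y) (pr (subst_fuel k' t v p) (subst_fuel k' t v q))).

Definition subst_code (x t v : nat) : nat := subst_fuel x.+1 t v x.

Lemma subst_fuel_irrelevant k k' t v z : z < k -> z < k' ->
  subst_fuel k t v z = subst_fuel k' t v z.
Proof.
elim: k k' z => // k IH [//|k'] z lzk lzk'.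
have IH2 x : x < z -> subst_fuel k t v x = subst_fuel k' t v x.
  by move=> lxz; apply: IH; lia.
move: IH2 => {}IH /=; case E: (unpair z) => [[g x]|//]; case: ifP => // _.
have := unpair_some E => Ez.
case: ifP => [gu|_].
  rewrite IH // Ez ltn_pr2 //.
  by move: gu; case: (g).
case E2: (unpair x) => [[y w]|//]; have Ex := unpair_some E2.
have g0 : 0 < g -> [/\ x < z, y <= x & w <= x].
  by move=> g0; rewrite Ex leq_pr1 leq_pr2 Ez -Ex ltn_pr2.
case: ifP => [gb|_].
  have [|lx ly lw] := g0; first by move: gb; case: (g).
  by rewrite !IH //; lia.
case: ifP => [/eqP gA|_].
  have [|lx ly lw] := g0; first by rewrite gA.
  by rewrite IH //; lia.
case: eqP => //= gS.
have [|lx ly lw] := g0; first by rewrite gS.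
case E3: (unpair w) => [[p q]|//]; have Ew := unpair_some E3.
have lp : p <= w by rewrite Ew leq_pr1.
have lq : q <= w by rewrite Ew leq_pr2.
by rewrite !IH //; lia.
Qed.

Lemma subst_fuel_enough k t v z : z < k -> subst_fuel k t v z = subst_code z t v.
Proof. by move=> lzk; apply: subst_fuel_irrelevant. Qed.

Lemma subst_code_var i t v :
  subst_code (pr tagVar i) t v = if pr tagVar i == v then t else pr tagVar i.
Proof. by rewrite /subst_code /= unpairK. Qed.

Lemma subst_code_zero t v : subst_code (pr tagZero 0) t v = pr tagZero 0.
Proof. by rewrite /subst_code /= unpairK /=; case: (unpair 0) => // -[]. Qed.

Lemma subst_code_unary g x t v :
  g \in unary_tags -> subst_code (pr g x) t v = pr g (subst_code x t v).
Proof.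
move=> gu; rewrite {1}/subst_code /= unpairK.
have g0 : 0 < g by move: gu; case: (g).
case: eqP gu => [-> //|_ ->].
by rewrite subst_fuel_enough ?ltn_pr2.
Qed.

Lemma subst_code_binary g x y t v : g \in binary_tags ->
  subst_code (pr g (pr x y)) t v = pr g (pr (subst_code x t v) (subst_code y t v)).
Proof.
move=> gb; rewrite {1}/subst_code /= !unpairK.
have g0 : 0 < g by move: gb; case: (g).
have lt := @ltn_pr2 g (pr x y) g0; have lx := leq_pr1 x y; have ly := leq_pr2 x y.
have /allP/(_ g gb)/negPf -> : all (fun g => g \notin unary_tags) binary_tags by [].
case: eqP gb => [-> //|_ ->].
by rewrite !subst_fuel_enough //; apply: leq_ltn_trans lt.
Qed.

Lemma subst_code_sub x y z t v : subst_code (pr tagSub (pr x (pr y z))) t v =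
  pr tagSub (pr (subst_code x t v) (pr (subst_code y t v) (subst_code z t v))).
Proof.
rewrite {1}/subst_code /= !unpairK /=.
have lt := @ltn_pr2 tagSub (pr x (pr y z)) isT.
have lx := leq_pr1 x (pr y z); have lyz := leq_pr2 x (pr y z).
have ly := leq_pr1 y z; have lz := leq_pr2 y z.
have ltz := leq_ltn_trans lyz lt.
by rewrite !subst_fuel_enough //;
  [apply: leq_ltn_trans ltz | apply: leq_ltn_trans ltz | apply: leq_ltn_trans lt].
Qed.

Lemma subst_code_all u x t v : subst_code (pr tagAll (pr u x)) t v =
  pr tagAll (pr u (if u == v then x else subst_code x t v)).
Proof.
rewrite {1}/subst_code /= !unpairK /=.
have lt := @ltn_pr2 tagAll (pr u x) isT; have lx := leq_pr2 u x.
by rewrite (subst_fuel_enough _ _ (leq_ltn_trans lx lt)).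
Qed.

Lemma subst_code_other z t v :
  (forall i, z <> pr tagVar i) ->
  (forall g x, g \in unary_tags -> z <> pr g x) ->
  (forall g x y, g \in binary_tags -> z <> pr g (pr x y)) ->
  (forall x y w, z <> pr tagSub (pr x (pr y w))) ->
  (forall u x, z <> pr tagAll (pr u x)) ->
  subst_code z t v = z.
Proof.
move=> nv n1 n2 ns na; rewrite /subst_code /=.
case E: (unpair z) => [[g x]|//]; have Ez := unpair_some E.
case: eqP => [Eg|_]; first by case: (nv x); rewrite -Eg.
case: ifP => [/n1 /(_ Ez) //|_].
case E2: (unpair x) => [[y w]|//]; have Ex := unpair_some E2.
case: ifP => [/(n2 _ y w)|_]; first by rewrite -Ex.
case: eqP => [Eg|_]; first by case: (na y w); rewrite -Ex -Eg.
case: eqP => //= Eg; case E3: (unpair w) => [[p q]|//]; have Ew := unpair_some E3.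
by case: (ns y p q); rewrite -Ew -Ex -Eg.
Qed.

(** On codes of expressions the function is the syntactic substitution. *)
Lemma subst_code_codet x s t : subst_code (codet t) (codet s) (codet (tVar x)) =
  codet (substt x s t).
Proof.
elim: t => [i||f t IH|f t1 IH1 t2 IH2|t1 IH1 t2 IH2 t3 IH3].
- rewrite subst_code_var /=; case: (x =P i) => [->|n]; first by rewrite eqxx.
  by case: eqP => // /pr_inj [_ /esym].
- exact: subst_code_zero.
- by rewrite [LHS]subst_code_unary ?IH //; case: f.
- by rewrite [LHS]subst_code_binary ?IH1 ?IH2 //; case: f.
- by rewrite [LHS]subst_code_sub IH1 IH2 IH3.
Qed.

Lemma subst_code_code x s A : subst_code (code A) (codet s) (codet (tVar x)) =
  code (subst x s A).
Proof.
elim: A => [t u|t|t|A IH|A IHA B IHB|y A IH].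
- by rewrite [LHS]subst_code_binary ?subst_code_codet.
- by rewrite [LHS]subst_code_unary ?subst_code_codet.
- by rewrite [LHS]subst_code_unary ?subst_code_codet.
- by rewrite [LHS]subst_code_unary ?IH.
- by rewrite [LHS]subst_code_binary ?IHA ?IHB.
- rewrite [LHS]subst_code_all /=; case: (x =P y) => [->|n]; first by rewrite eqxx.
  by rewrite IH; case: eqP => // /pr_inj [_ /esym].
Qed.

(** * Evaluation of formulas *)

Definition env := nat -> nat.

Definition upd (e : env) (x n : nat) : env := fun y => if y == x then n else e y.

(** Formulas with free variables are assigned truth values at this environment,
    so that truth of codes can be defined for all formulas at once. *)
Definition env0 : env := fun=> 0.

(** The standard interpretation of the function symbols. *)
Definition fun1_sem (f : fun1) (n : nat) : nat :=
  match f with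
  | Succ => n.+1
  | Num => codet (numeral n)
  | NegF => pr tagNeg n
  | TrF => pr tagTr n
  | DetF => pr tagDet n
  end.

Definition fun2_sem (f : fun2) (m n : nat) : nat :=
  match f with
  | Add => m + n
  | Mul => m * n
  | EqF => pr tagEq (pr m n)
  | ConjF => pr tagConj (pr m n)
  | AllF => pr tagAll (pr m n)
  end.

Fixpoint val (e : env) (t : term) : nat :=
  match t with
  | tVar x => e x
  | tZero => 0
  | tFun1 f t1 => fun1_sem f (val e t1)
  | tFun2 f t1 t2 => fun2_sem f (val e t1) (val e t2)
  | tSub t1 t2 t3 => subst_code (val e t1) (val e t2) (val e t3)
  end.

(** Classical satisfaction and strong Kleene evaluation are both recursions on
    formulas; they are instances of evaluation in an algebra of truth values, so
    that the substitution lemma is proved only once. *)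
Record algebra := Algebra {
  carrier : Type;
  a_eq : bool -> carrier;
  a_tr : nat -> carrier;
  a_det : nat -> carrier;
  a_neg : carrier -> carrier;
  a_conj : carrier -> carrier -> carrier;
  a_all : (nat -> carrier) -> carrier }.

Fixpoint eval (S : algebra) (A : form) (e : env) : carrier S :=
  match A with
  | fEq s t => a_eq S (val e s == val e t)
  | fTr t => a_tr S (val e t)
  | fDet t => a_det S (val e t)
  | fNeg B => a_neg (eval S B e)
  | fConj B C => a_conj (eval S B e) (eval S C e)
  | fAll x B => a_all (fun n => eval S B (upd e x n))
  end.

Lemma val_ext e e' t : (forall x, occurs x t -> e x = e' x) -> val e t = val e' t.
Proof.
elim: t => [x||f t IH|f t1 IH1 t2 IH2|t1 IH1 t2 IH2 t3 IH3] //= H.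
- by apply: H; rewrite /= eqxx.
- by rewrite IH.
- by rewrite IH1 ?IH2 // => x ox; apply: H; rewrite ox ?orbT.
- by rewrite IH1 ?IH2 ?IH3 // => x ox; apply: H; rewrite ox ?orbT.
Qed.

Lemma eval_ext S e e' A :
  (forall x, free x A -> e x = e' x) -> eval S A e = eval S A e'.
Proof.
elim: A e e' => [s t|t|t|A IH|A IHA B IHB|y A IH] e e' /= H.
- congr (a_eq _ (_ == _)); apply: val_ext => x ox; apply: H; by rewrite ox ?orbT.
- by congr a_tr; apply: val_ext.
- by congr a_det; apply: val_ext.
- by congr a_neg; apply: IH.
- by congr a_conj; [apply: IHA | apply: IHB] => x fx; apply: H; rewrite fx ?orbT.
- congr a_all; apply: funext => n; apply: IH => x fx; rewrite /upd.
  by case: eqP => // /eqP ne; apply: H; rewrite ne.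
Qed.

Lemma val_substt e x s t : val e (substt x s t) = val (upd e x (val e s)) t.
Proof.
elim: t => [y||f t IH|f t1 IH1 t2 IH2|t1 IH1 t2 IH2 t3 IH3] //=.
- by rewrite /upd eq_sym; case: eqP.
- by rewrite IH.
- by rewrite IH1 IH2.
- by rewrite IH1 IH2 IH3.
Qed.

Lemma substt_not_occurs x s t : ~~ occurs x t -> substt x s t = t.
Proof.
elim: t => [y||f t IH|f t1 IH1 t2 IH2|t1 IH1 t2 IH2 t3 IH3] //=.
- by case: eqP.
- by move=> /IH ->.
- by rewrite negb_or => /andP[/IH1 -> /IH2 ->].
- by rewrite !negb_or => /and3P[/IH1 -> /IH2 -> /IH3 ->].
Qed.

Lemma subst_not_free x s A : ~~ free x A -> subst x s A = A.
Proof.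
elim: A => [t u|t|t|A IH|A IHA B IHB|y A IH] //=.
- by rewrite negb_or => /andP[n1 n2]; rewrite !substt_not_occurs.
- by move=> n; rewrite substt_not_occurs.
- by move=> n; rewrite substt_not_occurs.
- by move=> /IH ->.
- by rewrite negb_or => /andP[/IHA -> /IHB ->].
- by case: eqP => //= _ /IH ->.
Qed.

(** Substitution does not rename bound variables, hence the hypothesis that
    nothing is captured. *)
Lemma eval_subst S e x s A : freefor x s A ->
  eval S (subst x s A) e = eval S A (upd e x (val e s)).
Proof.
elim: A e => [t u|t|t|A IH|A IHA B IHB|y A IH] e /= ff; rewrite ?val_substt //.
- by rewrite IH.
- by case/andP: ff => fA fB; rewrite IHA ?IHB.
- case: (x =P y) ff => [-> _ | ne] /=.
    congr a_all; apply: funext => n; apply: eval_ext => z _.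
    by rewrite /upd; case: eqP.
  move=> ff; congr a_all; apply: funext => n.
  case/orP: ff => [nf | /andP[no fA]].
    rewrite subst_not_free //; apply: eval_ext => z fz; rewrite /upd.
    by case: (z =P x) fz nf => [->|] // fz; rewrite fz.
  rewrite IH //; apply: eval_ext => z _; rewrite /upd.
  have -> : val (fun w => if w == y then n else e w) s = val e s.
    by apply: val_ext => w ow; case: eqP ow no => // -> ->.
  by case: (z =P x) => // ->; case: eqP.
Qed.

Definition closedt (t : term) : Prop := forall x, ~~ occurs x t.

Lemma freefor_closed x t A : closedt t -> freefor x t A.
Proof.
move=> ct; elim: A => //= [A -> B -> //|y A ->].
by rewrite ct orbT.
Qed.

Lemma occurs_numeral x n : occurs x (numeral n) = false.
Proof. by elim: n. Qed.

Lemma closedt_numeral n : closedt (numeral n).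
Proof. by move=> x; rewrite occurs_numeral. Qed.

Lemma val_numeral e n : val e (numeral n) = n.
Proof. by elim: n => //= n ->. Qed.

Definition classical (T D : nat -> Prop) : algebra :=
  @Algebra Prop is_true T D not and (fun P => forall n, P n).

Notation sat T D := (eval (classical T D)).

Lemma sat_imp T D A B e : sat T D (fImp A B) e <-> (sat T D A e -> sat T D B e).
Proof.
rewrite /=; split=> [H a | H [a nb]]; last exact: nb (H a).
by apply: contrapT => nb; apply: H.
Qed.

(** Propositional tautologies are treated by the boolean reflection of
    satisfaction, which is a valuation in the sense of [tautology]. *)
Theorem soundness T D Th A :
  (forall B, Th B -> forall e, sat T D B e) ->
  derivable Th A -> forall e, sat T D A e.
Proof.
move=> sTh.
elim=> {A} [A /sTh //|A tA|x t A ff|x A B nf|t|x s t A fs ft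
           |A B _ IH1 _ IH2|x A _ IH] e.
- apply/asboolP; apply: (tA (fun B => `[< sat T D B e >])) => [B|B C] /=.
    exact: asbool_neg.
  exact: asbool_and.
- by apply/sat_imp; rewrite eval_subst //=; apply.
- apply/sat_imp => H; apply/sat_imp => a n; have /sat_imp := H n; apply.
  rewrite -(@eval_ext _ e) // => y fy; rewrite /upd.
  by case: eqP fy nf => // -> ->.
- by rewrite /= eqxx.
- apply/sat_imp => /= /eqP E; apply/sat_imp.
  by rewrite !eval_subst // E.
- by have /sat_imp := IH1 e; apply.
- by move=> n; apply: IH.
Qed.

(** * Denotations of parametrised formulas *)

(** A [pform] is a formula waiting for a level, and its parameters are terms that
    only involve variables below that level.  The meaning of such an object is
    therefore relative to a level k and an assignment e of the variables below k,
    and is required to persist to all higher levels and all extensions of e, as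
    in a Kripke frame whose worlds are the pairs of a level and an assignment.
    This makes meanings compositional: a quantifier of [pform] passes to the world
    in which the next variable has received a value. *)
Definition agree (k : nat) (e e' : env) : Prop := forall i, i < k -> e' i = e i.

Definition tden (k : nat) (e : env) (t : term) (n : nat) : Prop :=
  forall e', agree k e e' -> val e' t = n.

Definition den (T D : nat -> Prop) (k : nat) (e : env) (P : pform) (Q : Prop) : Prop :=
  forall k' e', k <= k' -> agree k e e' -> sat T D (P k') e' <-> Q.

(** The parametrised formula S means R: it sends terms denoting n, in any later
    world, to formulas meaning R n. *)
Definition pden (T D : nat -> Prop) (k : nat) (e : env) (S : term -> pform) (R : nat -> Prop) :=
  forall k' e' t n, k <= k' -> agree k e e' -> tden k' e' t n ->
  den T D k' e' (S t) (R n).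

Lemma agree_refl k e : agree k e e.
Proof. by []. Qed.

Lemma agree_trans k k' e e' e'' :
  k <= k' -> agree k e e' -> agree k' e' e'' -> agree k e e''.
Proof. by move=> le A A' i lik; rewrite A' ?A //; apply: leq_trans le. Qed.

Lemma tden_mono k e t n k' e' :
  tden k e t n -> k <= k' -> agree k e e' -> tden k' e' t n.
Proof. by move=> H le A e'' A'; apply: H; apply: agree_trans A'. Qed.

Lemma pden_mono T D k e S R k' e' :
  pden T D k e S R -> k <= k' -> agree k e e' -> pden T D k' e' S R.
Proof.
move=> H le A k'' e'' t n le' A' td; apply: H => //; first exact: leq_trans le'.
exact: agree_trans A'.
Qed.

Lemma den_ext T D k e P Q Q' :
  den T D k e P Q -> (Q <-> Q') -> den T D k e P Q'.
Proof. by move=> H E k' e' le A; rewrite (H k' e' le A). Qed.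

Lemma den_sat T D P Q : den T D 0 env0 P Q -> forall e, sat T D (P 0) e <-> Q.
Proof. by move=> H e; apply: H. Qed.

Lemma tden_zero k e : tden k e tZero 0.
Proof. by []. Qed.

Lemma tden_fun1 k e f t n : tden k e t n -> tden k e (tFun1 f t) (fun1_sem f n).
Proof. by move=> H e' A /=; rewrite H. Qed.

Lemma tden_fun2 k e f s t m n : tden k e s m -> tden k e t n ->
  tden k e (tFun2 f s t) (fun2_sem f m n).
Proof. by move=> H1 H2 e' A /=; rewrite H1 ?H2. Qed.

Lemma tden_sub k e s t u m n l : tden k e s m -> tden k e t n -> tden k e u l ->
  tden k e (tSub s t u) (subst_code m n l).
Proof. by move=> H1 H2 H3 e' A /=; rewrite H1 ?H2 ?H3. Qed.

Lemma tden_numeral k e n : tden k e (numeral n) n.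
Proof. by move=> e' _; rewrite val_numeral. Qed.

Lemma tden_tpr k e s t m n : tden k e s m -> tden k e t n ->
  tden k e (tpr s t) (pr m n).
Proof. by move=> H1 H2 e' A /=; rewrite H1 ?H2. Qed.

Section Connectives.
Variables (T D : nat -> Prop) (k : nat) (e : env).
Local Notation den := (den T D k e).

Lemma den_eq s t m n : tden k e s m -> tden k e t n -> den (s ≐ t) (m = n).
Proof. by move=> H1 H2 k' e' le A /=; rewrite H1 ?H2 //; split=> /eqP. Qed.

(** The equation is a separate premise so that, when Q is still unknown, it is
    solved after the value n of t has been found. *)
Lemma den_tr t n Q : tden k e t n -> Q = T n -> den (pTr t) Q.
Proof. by move=> H -> k' e' le A /=; rewrite H. Qed.

Lemma den_det t n Q : tden k e t n -> Q = D n -> den (pDet t) Q.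
Proof. by move=> H -> k' e' le A /=; rewrite H. Qed.

Lemma den_neg P Q : den P Q -> den (¬ P) (~ Q).
Proof. by move=> H k' e' le A /=; rewrite H. Qed.

Lemma den_conj P1 Q1 P2 Q2 : den P1 Q1 -> den P2 Q2 -> den (P1 ∧ P2) (Q1 /\ Q2).
Proof. by move=> H1 H2 k' e' le A /=; rewrite H1 ?H2. Qed.

Lemma den_imp P1 Q1 P2 Q2 : den P1 Q1 -> den P2 Q2 -> den (P1 ⇒ P2) (Q1 -> Q2).
Proof.
move=> H1 H2 k' e' le A.
have E1 := H1 k' e' le A; have E2 := H2 k' e' le A.
split=> [/sat_imp h q | h]; first by apply/E2/h/E1.
by apply/sat_imp => q; apply/E2/h/E1.
Qed.

Lemma den_or P1 Q1 P2 Q2 : den P1 Q1 -> den P2 Q2 -> den (P1 ∨ P2) (Q1 \/ Q2).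
Proof.
move=> H1 H2 k' e' le A /=; rewrite H1 ?H2 //.
split=> [H|]; last by tauto.
by case: (pselect Q1) => [|n1]; [left | right; apply: contrapT => n2; apply: H].
Qed.

Lemma den_false : den pFalse False.
Proof. by move=> k' e' le A /=; split=> // /(_ erefl). Qed.

Lemma den_equiv P1 Q1 P2 Q2 : den P1 Q1 -> den P2 Q2 -> den (P1 ⇔ P2) (Q1 <-> Q2).
Proof. by move=> H1 H2; apply: den_conj; apply: den_imp. Qed.

End Connectives.

(** The bound variable has index the current level k', so the body is read at
    level k' + 1, where that variable denotes the number assigned to it. *)
Lemma den_all T D k e P Q :
  pden T D k e P Q -> den T D k e (pAll P) (forall n, Q n).
Proof.
move=> H k' e' le A /=.
have S n : sat T D (P (tVar k') k'.+1) (upd e' k' n) <-> Q n.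
  apply: (H k'.+1 (upd e' k' n)) => //; first exact: leqW.
    move=> i lik; rewrite /upd -A //; case: eqP => // E.
    by move: (leq_trans lik le); rewrite E ltnn.
  by move=> e'' /(_ k' (ltnSn k')) /= ->; rewrite /upd eqxx.
by split=> h n; apply/S.
Qed.

Lemma den_ex T D k e P Q :
  pden T D k e P Q -> den T D k e (pEx P) (exists n, Q n).
Proof.
move=> H; apply: (@den_ext _ _ _ _ _ (~ (forall n, ~ Q n))); last first.
  split=> [h|[n q] /(_ n)]; last exact.
  by apply: contrapT => nq; apply: h => n q; apply: nq; exists n.
apply: den_neg; apply: (@den_all _ _ _ _ _ (fun n => ~ Q n)) => k' e' t n le A td.
by apply: den_neg; apply: H.
Qed.

Lemma den_allIn T D k e S P R Q : pden T D k e S R -> pden T D k e P Q ->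
  den T D k e (pAllIn S P) (forall n, R n -> Q n).
Proof.
move=> HS HP; apply: (@den_all _ _ _ _ _ (fun n => R n -> Q n)) => k' e' t n le A td.
by apply: den_imp; [apply: HS | apply: HP].
Qed.

Lemma den_exIn T D k e S P R Q : pden T D k e S R -> pden T D k e P Q ->
  den T D k e (pExIn S P) (exists n, R n /\ Q n).
Proof.
move=> HS HP; apply: den_ex => k' e' t n le A td.
by apply: den_conj; [apply: HS | apply: HP].
Qed.

Lemma den_ors T D k e (I : Type) (s : seq I) P Q :
  (forall i, den T D k e (P i) (Q i)) ->
  den T D k e (pOrs s P) (exists i, List.In i s /\ Q i).
Proof.
move=> H; elim: s => [|i s IH].
  by apply: den_ext (@den_false _ _ _ _) _; split=> // -[i []].
apply: den_ext (den_or (H i) IH) _; split=> [[q|[j [js q]]]|[j [[<-|js] q]]].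
- by exists i; split=> //; left.
- by exists j; split=> //; right.
- by left.
- by right; exists j.
Qed.

Lemma den_fun1s T D k e P Q : (forall f, den T D k e (P f) (Q f)) ->
  den T D k e (pOrs fun1s P) (exists f, Q f).
Proof.
move=> H; apply: den_ext (den_ors fun1s H) _.
split=> [[f [_ q]]|[f q]]; exists f => //; split=> //; case: (f) => /=; tauto.
Qed.

Lemma den_fun2s T D k e P Q : (forall f, den T D k e (P f) (Q f)) ->
  den T D k e (pOrs fun2s P) (exists f, Q f).
Proof.
move=> H; apply: den_ext (den_ors fun2s H) _.
split=> [[f [_ q]]|[f q]]; exists f => //; split=> //; case: (f) => /=; tauto.
Qed.

(** Enters the world of a quantifier and transports all known denotations to
    it. *)
Ltac lift_world :=
  let k' := fresh "k" in let e' := fresh "e" in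
  let x := fresh "x" in let n := fresh "n" in
  let le := fresh "le" in let ag := fresh "ag" in let xn := fresh "xn" in
  intros k' e' x n le ag xn;
  repeat match goal with
    | H : tden _ _ _ _ |- _ => apply (fun h => tden_mono h le ag) in H
    | H : pden _ _ _ _ _ _ |- _ => apply (fun h => pden_mono h le ag) in H
    end;
  clear le ag.

(** The two hooks are extended as denotations of defined terms and formulas
    become available. *)
Ltac tden_base := fail.

Ltac den_base := fail.

Ltac tden_tac :=
  lazymatch goal with
  | |- tden _ _ tZero _ => apply tden_zero
  | |- tden _ _ (numeral _) _ => apply tden_numeral
  | |- tden _ _ (tpr _ _) _ => eapply tden_tpr; tden_tac
  | |- tden _ _ (cVar _) _ => unfold cVar; tden_tac
  | |- tden _ _ cZero _ => unfold cZero; tden_tac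
  | |- tden _ _ (cFun1 _ _) _ => unfold cFun1; tden_tac
  | |- tden _ _ (cFun2 _ _ _) _ => unfold cFun2; tden_tac
  | |- tden _ _ (cSub _ _ _) _ => unfold cSub; tden_tac
  | |- tden _ _ (tFun1 ?f _) _ => eapply (@tden_fun1 _ _ f); tden_tac
  | |- tden _ _ (tFun2 ?f _ _) _ => eapply (@tden_fun2 _ _ f); tden_tac
  | |- tden _ _ (tSub _ _ _) _ => eapply tden_sub; tden_tac
  | |- tden _ _ _ _ => first [eassumption | tden_base]
  end.

(** Computes the meaning of a [pform] by recursion on its structure. *)
Ltac den_tac :=
  cbv beta;
  lazymatch goal with
  | |- pden _ _ _ _ _ _ => first [eassumption | lift_world; den_tac]
  | |- tden _ _ _ _ => tden_tac
  | |- den _ _ _ _ (_ ≐ _) _ => eapply den_eq; tden_tac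
  | |- den _ _ _ _ (pTr _) _ => eapply den_tr; [tden_tac | reflexivity]
  | |- den _ _ _ _ (pDet _) _ => eapply den_det; [tden_tac | reflexivity]
  | |- den _ _ _ _ (pIff _ _) _ => eapply den_equiv; den_tac
  | |- den _ _ _ _ (pImp _ _) _ => eapply den_imp; den_tac
  | |- den _ _ _ _ (pOr _ _) _ => eapply den_or; den_tac
  | |- den _ _ _ _ pFalse _ => eapply den_false
  | |- den _ _ _ _ (pConj _ _) _ => eapply den_conj; den_tac
  | |- den _ _ _ _ (pNeg _) _ => eapply den_neg; den_tac
  | |- den _ _ _ _ (pAll _) _ => eapply den_all; den_tac
  | |- den _ _ _ _ (pEx _) _ => eapply den_ex; den_tac
  | |- den _ _ _ _ (pAllIn _ _) _ => eapply den_allIn; den_tac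
  | |- den _ _ _ _ (pExIn _ _) _ => eapply den_exIn; den_tac
  | |- den _ _ _ _ (pOrs fun1s _) _ => eapply den_fun1s; intros ?; den_tac
  | |- den _ _ _ _ (pOrs fun2s _) _ => eapply den_fun2s; intros ?; den_tac
  | |- den _ _ _ _ (pOrs _ _) _ => eapply den_ors; intros ?; den_tac
  | H : pden _ _ _ _ ?S _ |- den _ _ _ _ (?S _) _ =>
      eapply H; [exact (leqnn _) | exact (@agree_refl _ _) | tden_tac]
  | |- den _ _ _ _ _ _ => solve [den_base]
  end.

Definition VarCode (n : nat) : Prop := exists i, n = pr tagVar i.

Lemma den_Var T D k e t n : tden k e t n -> den T D k e (pVar t) (VarCode n).
Proof. by move=> Ht; rewrite /pVar /VarCode; den_tac. Qed.

Lemma den_lt T D k e s t m n : tden k e s m -> tden k e t n ->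
  den T D k e (pLt s t) (m < n).
Proof.
move=> Hs Ht; apply: den_ext; first by rewrite /pLt; den_tac.
move=> /=; split=> [[w]|lmn]; first lia.
by exists (n - m.+1); lia.
Qed.

Ltac den_base ::= eapply den_lt; tden_tac.

Lemma den_beta T D k e s t u v a b i z :
  tden k e s a -> tden k e t b -> tden k e u i -> tden k e v z ->
  den T D k e (pBeta s t u v) (z = beta a b i).
Proof.
move=> Ha Hb Hi Hz; apply: den_ext; first by rewrite /pBeta; den_tac.
rewrite /beta /=; split=> [[q [-> lt]]|->].
  by rewrite modnMDl modn_small.
by exists (a %/ (i.+1 * b).+1); rewrite -divn_eq ltn_pmod.
Qed.

Ltac den_arith :=
  lazymatch goal with
  | |- den _ _ _ _ (pLt _ _) _ => eapply den_lt; tden_tac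
  | |- den _ _ _ _ (pBeta _ _ _ _) _ => eapply den_beta; tden_tac
  | |- den _ _ _ _ (pVar _) _ => eapply den_Var; tden_tac
  end.

Ltac den_base ::= den_arith.

(** The meaning of [pInd]: the last entry of a sequence, coded by the beta
    function, whose entries are all generated by F from earlier ones.  It is used
    through [Derived_ind] and [Derived_step], by which it is the set inductively
    generated by F when F is monotone and finitary. *)
Definition Derived (F : (nat -> Prop) -> nat -> Prop) (n : nat) : Prop :=
  exists a b l, n = beta a b l /\
    forall i, i < l.+1 -> forall z, z = beta a b i ->
      F (fun y => exists j, j < i /\ y = beta a b j) z.

Definition monotone (F : (nat -> Prop) -> nat -> Prop) : Prop :=
  forall R R' : nat -> Prop, (forall n, R n -> R' n) ->
  forall n, F R n -> F R' n.

Lemma den_ind T D k e step F x n :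
  (forall k' e' prev R z m, k <= k' -> agree k e e' ->
     pden T D k' e' prev R -> tden k' e' z m ->
     den T D k' e' (step prev z) (F R m)) ->
  tden k e x n -> den T D k e (pInd step x) (Derived F n).
Proof.
move=> Hstep Hx; rewrite /pInd /Derived.
eapply den_ex => k1 e1 a a' le1 ag1 Ha.
eapply den_ex => k2 e2 b b' le2 ag2 Hb.
eapply den_ex => k3 e3 l l' le3 ag3 Hl.
have le : k <= k3 by lia.
have ag : agree k e e3 by apply: agree_trans ag3; [lia | apply: agree_trans ag2].
have {}Ha := tden_mono (tden_mono Ha le2 ag2) le3 ag3.
have {}Hb := tden_mono Hb le3 ag3.
have {}Hx := tden_mono Hx le ag.
eapply den_conj; first by den_tac.
eapply den_all => k4 e4 i i' le4 ag4 Hi.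
have {}Ha := tden_mono Ha le4 ag4; have {}Hb := tden_mono Hb le4 ag4.
have {}Hl := tden_mono Hl le4 ag4.
eapply den_imp; first by eapply den_lt; [den_tac | exact: tden_fun1 Hl].
eapply den_all => k5 e5 z z' le5 ag5 Hz.
have {}Ha := tden_mono Ha le5 ag5; have {}Hb := tden_mono Hb le5 ag5.
have {}Hi := tden_mono Hi le5 ag5.
eapply den_imp; first by den_tac.
apply: Hstep => //; first by lia.
  by apply: agree_trans ag5; [lia | apply: agree_trans ag4].
den_tac.
Qed.

Lemma Derived_ind F (S : nat -> Prop) : monotone F ->
  (forall n, F S n -> S n) -> forall n, Derived F n -> S n.
Proof.
move=> mono cl n [a [b [l [-> H]]]].
have {n} : forall i, i < l.+1 -> S (beta a b i); last exact.
elim/ltn_ind => i IH li; apply/cl/(mono _ _ _ _ (H i li _ erefl)).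
by move=> y [j [lj ->]]; apply: IH => //; lia.
Qed.

(** Derivations as lists, which can be concatenated; [beta_seq] turns them into
    coded sequences. *)
Definition chain (F : (nat -> Prop) -> nat -> Prop) (s : seq nat) : Prop :=
  forall i, i < size s -> F (fun y => y \in take i s) (nth 0 s i).

Lemma chain_cat F s1 s2 : monotone F ->
  chain F s1 -> chain F s2 -> chain F (s1 ++ s2).
Proof.
move=> mono c1 c2 i; rewrite size_cat nth_cat take_cat => li.
case: ltnP => [l1|l1]; first exact: c1.
apply: (mono _ _ _ _ (c2 (i - size s1) _)); last by lia.
by move=> y; rewrite mem_cat => ->; rewrite orbT.
Qed.

Lemma Derived_chain F n : monotone F ->
  Derived F n <-> exists s, chain F (rcons s n).
Proof.
move=> mono; split=> [[a [b [l [-> H]]]]|[s c]].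
  exists (mkseq (beta a b) l); rewrite -mkseqS => i.
  rewrite size_mkseq => li; rewrite nth_mkseq //.
  apply: (mono _ _ _ _ (H i li _ erefl)) => y [j [lj ->]].
  by rewrite -map_take take_iota; apply: map_f; rewrite mem_iota; lia.
have [a [b E]] := beta_seq (rcons s n).
exists a, b, (size s); split.
  by rewrite E ?size_rcons // nth_rcons ltnn eqxx.
move=> i li _ ->; have li' : i < size (rcons s n) by rewrite size_rcons.
rewrite E //; apply: (mono _ _ _ _ (c i li')) => y yi.
have [j lj Ej] := nthP 0 yi; move: lj; rewrite size_takel; last exact: ltnW.
move=> lj; exists j; split=> //; rewrite E; last exact: ltn_trans lj _.
by rewrite -Ej nth_take.
Qed.

(** Concatenating derivations of the finitely many premises in l, and adding n at
    the end, yields a derivation of n. *)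
Lemma Derived_step F (l : seq nat) n : monotone F ->
  (forall y, y \in l -> Derived F y) -> F (fun y => y \in l) n -> Derived F n.
Proof.
move=> mono Hl Hn.
have [s cs ls] : exists2 s, chain F s & {subset l <= s}.
  elim: l Hl {Hn} => [|x l IH] Hl; first by exists [::].
  have [s cs ls] : exists2 s, chain F s & {subset l <= s}.
    by apply: IH => y yl; apply: Hl; rewrite inE yl orbT.
  have /(Derived_chain _ mono) [s' cs'] := Hl x (mem_head _ _).
  exists (rcons s' x ++ s); first exact: chain_cat.
  move=> y; rewrite inE mem_cat mem_rcons inE => /orP[->//|/ls ->].
  by rewrite orbT.
apply/(Derived_chain _ mono); exists s => i; rewrite size_rcons ltnS leq_eqVlt.
case/orP=> [/eqP ->|li]; rewrite nth_rcons -cats1.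
  rewrite ltnn eqxx take_cat ltnn subnn take0 cats0.
  exact: mono Hn.
by rewrite li takel_cat ?(ltnW li) //; apply: cs.
Qed.

(** * Coded syntax *)

(** The meanings of the generating steps of terms, of formulas and of the graph
    of evaluation. *)
Definition TermStep (V R : nat -> Prop) (z : nat) : Prop :=
  (VarCode z /\ V z)
  \/ z = pr tagZero 0
  \/ (exists f x, R x /\ z = pr (tag1 f) x)
  \/ (exists f x y, R x /\ R y /\ z = pr (tag2 f) (pr x y))
  \/ (exists x y w, R x /\ R y /\ R w /\ z = pr tagSub (pr x (pr y w))).

Definition FormStep (L : lang) (At : nat -> Prop)
    (Q : (nat -> Prop) -> nat -> nat -> Prop) (R : nat -> Prop) (z : nat) : Prop :=
  (exists x y, At x /\ At y /\ z = pr tagEq (pr x y))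
  \/ (exists x, At x /\ z = pr tagTr x)
  \/ (if L is LD then exists x, At x /\ z = pr tagDet x else False)
  \/ (exists x, R x /\ z = pr tagNeg x)
  \/ (exists x y, R x /\ R y /\ z = pr tagConj (pr x y))
  \/ (exists v x, VarCode v /\ Q R v x /\ z = pr tagAll (pr v x)).

Definition ValStep (R : nat -> Prop) (z : nat) : Prop :=
  z = pr (pr tagZero 0) 0
  \/ (exists f x1 y1, R (pr x1 y1) /\ z = pr (pr (tag1 f) x1) (fun1_sem f y1))
  \/ (exists f x1 y1 x2 y2, R (pr x1 y1) /\ R (pr x2 y2) /\
        z = pr (pr (tag2 f) (pr x1 x2)) (fun2_sem f y1 y2))
  \/ (exists x1 y1 x2 y2 x3 y3, R (pr x1 y1) /\ R (pr x2 y2) /\ R (pr x3 y3) /\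
        z = pr (pr tagSub (pr x1 (pr x2 x3))) (subst_code y1 y2 y3)).

Lemma den_TermOver T D k e V V' t n :
  pden T D k e V V' -> tden k e t n ->
  den T D k e (pTermOver V t) (Derived (TermStep V') n).
Proof.
move=> HV Ht; apply: den_ind Ht => k' e' prev R z m le ag Hprev Hz.
have {}HV := pden_mono HV le ag; rewrite /TermStep; den_tac.
Qed.

Lemma den_pInd_Form T D k e L At At' Q Q' t n :
  pden T D k e At At' ->
  (forall k' e' prev R v m x l, k <= k' -> agree k e e' ->
    pden T D k' e' prev R -> tden k' e' v m -> tden k' e' x l ->
    den T D k' e' (Q prev v x) (Q' R m l)) ->
  tden k e t n ->
  den T D k e (pInd (pFormStep L At Q) t) (Derived (FormStep L At' Q') n).
Proof.
move=> HAt HQ Ht; apply: den_ind Ht => k' e' prev R z m le ag Hprev Hz.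
have {}HAt := pden_mono HAt le ag; rewrite /FormStep /pFormStep.
eapply den_or; first by den_tac.
eapply den_or; first by den_tac.
eapply den_or; first by case: L; den_tac.
eapply den_or; first by den_tac.
eapply den_or; first by den_tac.
apply: den_ex => k1 e1 v v' le1 ag1 Hv; apply: den_ex => k2 e2 x x' le2 ag2 Hx.
have {}Hz := tden_mono (tden_mono Hz le1 ag1) le2 ag2.
have {}Hprev := pden_mono (pden_mono Hprev le1 ag1) le2 ag2.
have {}Hv := tden_mono Hv le2 ag2.
apply: den_conj; first by den_tac.
apply: den_conj; last by den_tac.
apply: HQ => //; first by lia.
by apply: agree_trans ag2; [lia | apply: agree_trans ag1].
Qed.

Lemma den_Val T D k e s t m n : tden k e s m -> tden k e t n ->
  den T D k e (pVal s t) (Derived ValStep (pr m n)).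
Proof.
move=> Hs Ht; apply: den_ind; last by den_tac.
by move=> k' e' prev R z l le ag Hprev Hz; rewrite /ValStep; den_tac.
Qed.

Lemma TermStep_monotone V : monotone (TermStep V).
Proof. rewrite /TermStep => R R' H n; firstorder. Qed.

Lemma FormStep_monotone L At Q :
  (forall R R' : nat -> Prop, (forall n, R n -> R' n) ->
     forall v x, Q R v x -> Q R' v x) ->
  monotone (FormStep L At Q).
Proof.
move=> HQ R R' H n; rewrite /FormStep.
case=> [h|]; [by left | case=> [h|]; [by right; left | case=> [h|]]].
- by right; right; left.
- case=> [[x [/H rx ->]]|]; first by right; right; right; left; exists x.
  case=> [[x [y [/H rx [/H ry ->]]]]|[v [x [iv [/(HQ _ _ H) q ->]]]]].
    by right; right; right; right; left; exists x, y.
  by right; right; right; right; right; exists v, x.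
Qed.

Lemma ValStep_monotone : monotone ValStep.
Proof.
move=> R R' H n [->|[[f [x1 [y1 [r ->]]]]|[]]].
- by left.
- by right; left; exists f, x1, y1; split=> //; apply: H.
- move=> [f [x1 [y1 [x2 [y2 [r1 [r2 ->]]]]]]].
  by right; right; left; exists f, x1, y1, x2, y2; do !split=> //; apply: H.
- move=> [x1 [y1 [x2 [y2 [x3 [y3 [r1 [r2 [r3 ->]]]]]]]]].
  by right; right; right; exists x1, y1, x2, y2, x3, y3; do !split=> //; apply: H.
Qed.

Definition ClTermCode : nat -> Prop := Derived (TermStep (fun=> False)).

Lemma closedt_fun2 f s t : closedt (tFun2 f s t) -> closedt s /\ closedt t.
Proof.
by move=> c; split=> x; have := c x; rewrite /= negb_or => /andP[].
Qed.

Lemma closedt_sub s t u : closedt (tSub s t u) -> [/\ closedt s, closedt t & closedt u].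
Proof.
by move=> c; split=> x; have := c x; rewrite /= !negb_or => /and3P[].
Qed.

(** From left to right, axioms about all closed terms are verified on actual terms;
    from right to left, a universal hypothesis in T6 or D6 can be applied to the
    numerals, and witnesses in D6 can be given. *)
Lemma ClTermCodeP n : ClTermCode n <-> exists2 t, closedt t & codet t = n.
Proof.
split.
  apply: (@Derived_ind _ (fun n => exists2 t, closedt t & codet t = n)).
    exact: TermStep_monotone.
  move=> m [[_ []]|[->|[[f [x [[t ct <-] ->]]]|[]]]].
  - by exists tZero.
  - by exists (tFun1 f t).
  - move=> [f [x [y [[s cs <-] [[t ct <-] ->]]]]].
    by exists (tFun2 f s t) => // v; rewrite /= negb_or cs ct.
  - move=> [x [y [w [[s cs <-] [[t ct <-] [[u cu <-] ->]]]]]].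
    by exists (tSub s t u) => // v; rewrite /= !negb_or cs ct cu.
case=> t ct <-; elim: t ct => [i||f t IH|f s IHs t IHt|s IHs t IHt u IHu] c.
- by have := c i; rewrite /= eqxx.
- by apply: (@Derived_step _ [::]); [exact: TermStep_monotone | | right; left].
- apply: (@Derived_step _ [:: codet t]); first exact: TermStep_monotone.
    by move=> y; rewrite inE => /eqP ->; apply: IH.
  by right; right; left; exists f, (codet t); rewrite mem_head.
- have [cs ct] := closedt_fun2 c.
  apply: (@Derived_step _ [:: codet s; codet t]); first exact: TermStep_monotone.
    by move=> y; rewrite !inE => /orP[] /eqP ->; [apply: IHs | apply: IHt].
  right; right; right; left; exists f, (codet s), (codet t).
  by rewrite !inE !eqxx orbT.
- have [cs ct cu] := closedt_sub c.
  apply: (@Derived_step _ [:: codet s; codet t; codet u]); first exact: TermStep_monotone.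
    move=> y; rewrite !inE => /or3P[] /eqP ->; [exact: IHs | exact: IHt | exact: IHu].
  right; right; right; right; exists (codet s), (codet t), (codet u).
  by rewrite !inE !eqxx !orbT.
Qed.

Definition ValCode (s y : nat) : Prop := Derived ValStep (pr s y).

Lemma ValCodeP s y :
  ValCode s y <-> exists t, [/\ closedt t, codet t = s & val env0 t = y].
Proof.
split=> [vsy|[t [ct <- <-]]].
  have [t ct E] : exists2 t, closedt t & pr s y = pr (codet t) (val env0 t).
    pose S z := exists2 t, closedt t & z = pr (codet t) (val env0 t).
    apply: (@Derived_ind _ S _ _ _ vsy) => {vsy}; first exact: ValStep_monotone.
    move=> m [->|[[f [x1 [y1 [[t1 c1 /pr_inj [-> ->]] ->]]]]|[]]].
    - by exists tZero.
    - by exists (tFun1 f t1).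
    - move=> [f [x1 [y1 [x2 [y2 [[t1 c1 /pr_inj [-> ->]] [[t2 c2 /pr_inj [-> ->]] ->]]]]]]].
      by exists (tFun2 f t1 t2) => // v; rewrite /= negb_or c1 c2.
    - move=> [x1 [y1 [x2 [y2 [x3 [y3 [[t1 c1 /pr_inj [-> ->]] [[t2 c2 /pr_inj [-> ->]]
        [[t3 c3 /pr_inj [-> ->]] ->]]]]]]]]].
      by exists (tSub t1 t2 t3) => // v; rewrite /= !negb_or c1 c2 c3.
  by case/pr_inj: E => -> ->; exists t.
rewrite /ValCode.
elim: t ct => [i||f t IH|f t1 IH1 t2 IH2|t1 IH1 t2 IH2 t3 IH3] c.
- by have := c i; rewrite /= eqxx.
- by apply: (@Derived_step _ [::]); [exact: ValStep_monotone | | left].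
- apply: (@Derived_step _ [:: pr (codet t) (val env0 t)]); first exact: ValStep_monotone.
    by move=> m; rewrite inE => /eqP ->; apply: IH.
  by right; left; exists f, (codet t), (val env0 t); rewrite mem_head.
- have [c1 c2] := closedt_fun2 c.
  apply: (@Derived_step _ [:: pr (codet t1) (val env0 t1); pr (codet t2) (val env0 t2)]).
  + exact: ValStep_monotone.
  + by move=> m; rewrite !inE => /orP[] /eqP ->; [apply: IH1 | apply: IH2].
  right; right; left.
  exists f, (codet t1), (val env0 t1), (codet t2), (val env0 t2).
  by rewrite !inE !eqxx orbT.
- have [c1 c2 c3] := closedt_sub c.
  apply: (@Derived_step _ [:: pr (codet t1) (val env0 t1); pr (codet t2) (val env0 t2);
                          pr (codet t3) (val env0 t3)]).
  + exact: ValStep_monotone.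
  + move=> m; rewrite !inE => /or3P[] /eqP ->; [exact: IH1 | exact: IH2 | exact: IH3].
  right; right; right.
  exists (codet t1), (val env0 t1), (codet t2), (val env0 t2), (codet t3), (val env0 t3).
  by rewrite !inE !eqxx !orbT.
Qed.

Lemma ValCode_codet t y : closedt t -> ValCode (codet t) y <-> y = val env0 t.
Proof.
move=> ct; rewrite ValCodeP; split=> [[u [_ /codet_inj -> //]]|->].
by exists t.
Qed.

Definition TermCode : nat -> Prop := Derived (TermStep (fun=> ~ False)).

Definition AvoidCode (u : nat) : nat -> Prop := Derived (TermStep (fun z => z <> u)).

Definition FormCode (L : lang) : nat -> Prop :=
  Derived (FormStep L TermCode (fun R _ x => R x)).

Definition NotFreeCode (u : nat) : nat -> Prop :=
  Derived (FormStep LD (AvoidCode u) (fun R v x => (v = u /\ FormCode LD x) \/ R x)).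

Definition SentCode (L : lang) (n : nat) : Prop :=
  FormCode L n /\ forall u, VarCode u -> NotFreeCode u n.

Definition Form1Code (L : lang) (v n : nat) : Prop :=
  FormCode L n /\ forall u, VarCode u -> u <> v -> NotFreeCode u n.

Lemma TermCode_codet n : TermCode n -> exists t, codet t = n.
Proof.
apply: (@Derived_ind _ (fun n => exists t, codet t = n)).
  exact: TermStep_monotone.
move=> m [[[i ->] _]|[->|[[f [x [[t <-] ->]]]|[]]]].
- by exists (tVar i).
- by exists tZero.
- by exists (tFun1 f t).
- by move=> [f [x [y [[s <-] [[t <-] ->]]]]]; exists (tFun2 f s t).
- by move=> [x [y [w [[s <-] [[t <-] [[u <-] ->]]]]]]; exists (tSub s t u).
Qed.

(** The axioms only quantify universally over formulas, so for the models it is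
    enough that coded formulas come from formulas. *)
Lemma FormCode_code L n : FormCode L n -> exists A, code A = n.
Proof.
apply: (@Derived_ind _ (fun n => exists A, code A = n)).
  by apply: FormStep_monotone => R R' H v; apply: H.
move=> m [[x [y [/TermCode_codet [s <-] [/TermCode_codet [t <-] ->]]]]
         |[[x [/TermCode_codet [t <-] ->]]|[]]].
- by exists (fEq s t).
- by exists (fTr t).
- by case: L => // -[x [/TermCode_codet [t <-] ->]]; exists (fDet t).
move=> [[x [[A <-] ->]]|[[x [y [[A <-] [[B <-] ->]]]]|[v [x [[i ->] [[A <-] ->]]]]]].
- by exists (fNeg A).
- by exists (fConj A B).
- by exists (fAll i A).
Qed.

Lemma SentCode_code L n : SentCode L n -> exists A, code A = n.
Proof. by case=> /FormCode_code. Qed.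

Lemma Form1Code_code L v n : Form1Code L v n -> exists A, code A = n.
Proof. by case=> /FormCode_code. Qed.

(** The formula T(0) is the source of all counterexamples, so here the coded
    notions have to be verified. *)
Lemma SentCode_tr0 : SentCode LT (code (fTr tZero)).
Proof.
have zero V : Derived (TermStep V) (codet tZero).
  by apply: (@Derived_step _ [::]); [exact: TermStep_monotone | | right; left].
have tr0 L At Q : (forall R R' : nat -> Prop, (forall n, R n -> R' n) ->
     forall v x, Q R v x -> Q R' v x) -> At (codet tZero) ->
     Derived (FormStep L At Q) (code (fTr tZero)).
  move=> HQ At0; apply: (@Derived_step _ [::]) => //; first exact: FormStep_monotone.
  by right; left; exists (codet tZero).
split=> [|u _]; apply: tr0; try exact: zero; first by move=> R R' H v; apply: H.
by move=> R R' H v x [h|/H]; [left|right].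
Qed.

Lemma Form1Code_tr0 v : Form1Code LT v (code (fTr tZero)).
Proof. by case: SentCode_tr0 => f nf; split=> // u vu _; apply: nf. Qed.

Section Denotations.
Variables (T D : nat -> Prop) (k : nat) (e : env).

Lemma den_ClTerm t n : tden k e t n -> den T D k e (pClTerm t) (ClTermCode n).
Proof. by move=> Ht; apply: den_TermOver Ht; den_tac. Qed.

Lemma den_Term t n : tden k e t n -> den T D k e (pTerm t) (TermCode n).
Proof. by move=> Ht; apply: den_TermOver Ht; den_tac. Qed.

Lemma den_Avoid s t m n : tden k e s m -> tden k e t n ->
  den T D k e (pAvoid s t) (AvoidCode m n).
Proof. by move=> Hs Ht; apply: den_TermOver Ht; den_tac. Qed.

End Denotations.

Lemma den_Form T D k e L t n :
  tden k e t n -> den T D k e (pForm L t) (FormCode L n).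
Proof.
move=> Ht; apply: den_pInd_Form Ht => [k' e' s m le A Hs|]; first exact: den_Term.
by move=> k' e' prev R v m x l le A Hprev Hv Hx; apply: Hprev.
Qed.

Lemma den_NotFree T D k e s t m n : tden k e s m -> tden k e t n ->
  den T D k e (pNotFree s t) (NotFreeCode m n).
Proof.
move=> Hs Ht; apply: den_pInd_Form Ht => [k' e' u l le A Hu|].
  exact: den_Avoid (tden_mono Hs le A) Hu.
move=> k' e' prev R v l x l' le A Hprev Hv Hx.
have {}Hs := tden_mono Hs le A.
apply: den_or; last exact: Hprev.
by apply: den_conj; [exact: den_eq | exact: den_Form].
Qed.

Ltac den_syntax :=
  lazymatch goal with
  | |- den _ _ _ _ (pClTerm _) _ => eapply den_ClTerm; tden_tac
  | |- den _ _ _ _ (pForm _ _) _ => eapply den_Form; tden_tac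
  | |- den _ _ _ _ (pNotFree _ _) _ => eapply den_NotFree; tden_tac
  | |- den _ _ _ _ (pVal _ _) _ => eapply den_Val; tden_tac
  | |- _ => den_arith
  end.

Ltac den_base ::= den_syntax.

Lemma den_Sent T D k e L t n :
  tden k e t n -> den T D k e (pSent L t) (SentCode L n).
Proof. by move=> Ht; rewrite /pSent /SentCode; den_tac. Qed.

Lemma den_Form1 T D k e L s t m n : tden k e s m -> tden k e t n ->
  den T D k e (pForm1 L s t) (Form1Code L m n).
Proof. by move=> Hs Ht; rewrite /pForm1 /Form1Code; den_tac. Qed.

Lemma den_EqVal T D k e s t m n : tden k e s m -> tden k e t n ->
  den T D k e (pEqVal s t) (exists y, ValCode m y /\ ValCode n y).
Proof. by move=> Hs Ht; rewrite /pEqVal; den_tac. Qed.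

Lemma den_TrVal T D k e t n : tden k e t n ->
  den T D k e (pTrVal t) (exists y, ValCode n y /\ T y).
Proof. by move=> Ht; rewrite /pTrVal; den_tac. Qed.

Lemma den_DetVal T D k e t n : tden k e t n ->
  den T D k e (pDetVal t) (exists y, ValCode n y /\ D y).
Proof. by move=> Ht; rewrite /pDetVal; den_tac. Qed.

(** * The arithmetical axioms *)

Ltac den_base ::=
  lazymatch goal with
  | |- den _ _ _ _ (pSent _ _) _ => eapply den_Sent; tden_tac
  | |- den _ _ _ _ (pForm1 _ _ _) _ => eapply den_Form1; tden_tac
  | |- den _ _ _ _ (pEqVal _ _) _ => eapply den_EqVal; tden_tac
  | |- den _ _ _ _ (pTrVal _) _ => eapply den_TrVal; tden_tac
  | |- den _ _ _ _ (pDetVal _) _ => eapply den_DetVal; tden_tac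
  | |- _ => den_syntax
  end.

(** Reduces satisfaction of a closed axiom to its meaning. *)
Ltac by_den := refine (proj2 (@den_sat _ _ _ _ _ _) _); [den_tac | simpl].

(** The variable x itself is not captured: x is not free below a quantifier
    binding it. *)
Lemma freefor_succ x A : freefor x (tFun1 Succ (tVar x)) A.
Proof.
elim: A => //= [A -> B -> //|y A ->]; rewrite andbT [y == x]eq_sym.
by case: (x == y); rewrite ?orbT.
Qed.

Lemma mem_map_ex (I : Type) (U : eqType) (h : I -> U) s y :
  y \in map h s -> exists i, y = h i.
Proof.
elim: s => //= i s IH; rewrite inE => /orP[/eqP ->|/IH //].
by exists i.
Qed.

(** The arithmetical axioms hold in the standard model whatever T and D are. *)
Lemma PA_axiom_sound T D A : PA_axiom A -> forall e, sat T D A e.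
Proof.
case=> {A} [||||||x A||||||||||||f|f|||||||||] e; try by_den.
- by [].
- by move=> m n [].
- by move=> n; rewrite addn0.
- by move=> m n; rewrite addnS.
- by move=> n; rewrite muln0.
- by move=> m n; rewrite mulnS addnC.
- apply/sat_imp => -[A0 AS].
  have {}A0 : sat T D (subst x tZero A) e := A0.
  have {}AS n : sat T D (fImp A (subst x (tFun1 Succ (tVar x)) A)) (upd e x n) := AS n.
  elim=> [|n IH].
    by move: A0; rewrite eval_subst ?freefor_closed.
  have /sat_imp /(_ IH) := AS n; rewrite eval_subst ?freefor_succ //.
  set e' := upd _ _ _; suff -> : e' = upd e x n.+1 by [].
  by apply: funext => y; rewrite /e' /upd /= eqxx; case: eqP.
- by [].
- by [].
- by [].
- by [].
- by [].
- by [].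
- by [].
- by [].
- by move=> t i; rewrite subst_code_var eqxx.
- by move=> t v i ne; rewrite subst_code_var; case: eqP.
- by move=> t v; rewrite subst_code_zero.
- by move=> t v x; rewrite subst_code_unary //; case: f.
- by move=> t v x y; rewrite subst_code_binary //; case: f.
- by move=> t v x y z; rewrite subst_code_sub.
- by move=> t v x y; rewrite subst_code_binary.
- by move=> t v x; rewrite subst_code_unary.
- by move=> t v x; rewrite subst_code_unary.
- by move=> t v x; rewrite subst_code_unary.
- by move=> t v x y; rewrite subst_code_binary.
- by move=> t v x; rewrite subst_code_all eqxx.
- by move=> t v u x ne; rewrite subst_code_all; case: eqP.
- move=> t v z H; apply: subst_code_other.
  + by move=> i E; apply: H; left; exists i.
  + move=> g x; rewrite mem_cat => /orP[/mem_map_ex [f ->]|E].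
      by move=> Ez; apply: H; right; right; left; exists f, x.
    move=> Ez; apply: H; do 5 right; left; move: E; rewrite !inE.
    by case/or3P=> /eqP Eg; subst g; [exists TrF | exists DetF | exists NegF];
      (split; [tauto | exists x]).
  + move=> g x y; rewrite mem_cat => /orP[/mem_map_ex [f ->]|E].
      by move=> Ez; apply: H; right; right; right; left; exists f, x, y.
    move=> Ez; apply: H; do 6 right; move: E; rewrite !inE.
    by case/orP=> /eqP Eg; subst g; [exists EqF | exists ConjF];
      (split; [tauto | exists x, y]).
  + by move=> x y w Ez; apply: H; do 4 right; left; exists x, y, w.
  + by move=> u x Ez; apply: H; do 6 right; exists AllF; split; [tauto | exists u, x].
Qed.

(** The carrier consists of pairs of propositions, being determined with value
    true and being determined with value false, encoded as predicates of the
    value.  A formula D(t) is either determined and true or not determined at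
    all. *)
Definition kleene (P : bool -> nat -> Prop) : algebra :=
  @Algebra (bool -> Prop)
    (fun c b => c = b)
    (fun n b => P b n)
    (fun n b => b /\ exists c, P c n)
    (fun V b => V (~~ b))
    (fun V W b => if b then V true /\ W true else V false \/ W false)
    (fun V b => if b then forall n, V n true else exists n, V n false).

Lemma kleene_monotone (P Q : bool -> nat -> Prop) A e b :
  (forall c n, P c n -> Q c n) -> eval (kleene P) A e b -> eval (kleene Q) A e b.
Proof.
move=> H; elim: A e b => [s t|t|t|A IH|A IHA B IHB|x A IH] e b //=.
- exact: H.
- by case=> -> [c /H q]; split=> //; exists c.
- exact: IH.
- by case: b => -[]; [move=> /IHA a /IHB b | move=> /IHA; left | move=> /IHB; right].
- by case: b => [h n|[n /IH h]]; [apply: IH | exists n].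
Qed.

(** The least fixed point of strong Kleene evaluation, as the intersection of all
    relations closed under it: n codes a formula with determinate value b. *)
Definition detval (b : bool) (n : nat) : Prop :=
  forall P : bool -> nat -> Prop,
    (forall c A, eval (kleene P) A env0 c -> P c (code A)) -> P b n.

Lemma detval_intro b A : eval (kleene detval) A env0 b -> detval b (code A).
Proof.
move=> H P clP; apply: (clP); apply: kleene_monotone H => c n; exact.
Qed.

Lemma detval_elim b n : detval b n -> exists2 A, code A = n & eval (kleene detval) A env0 b.
Proof.
move=> d; apply: (d (fun b n => exists2 A, code A = n & eval (kleene detval) A env0 b)).
move=> c A H; exists A => //; apply: kleene_monotone H => {}c m [B <- h].
exact: detval_intro.
Qed.

Lemma detval_code b A : detval b (code A) <-> eval (kleene detval) A env0 b.
Proof.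
by split=> [/detval_elim [B /code_inj -> //]|]; apply: detval_intro.
Qed.

Definition det (n : nat) : Prop := exists b, detval b n.

Lemma det_code A : det (code A) <-> exists b, eval (kleene detval) A env0 b.
Proof. by split=> -[b h]; exists b; [apply/detval_code | exact: detval_intro]. Qed.

(** By induction on the least fixed point, for the stronger property that the
    opposite value is not determined: a Kleene value obtained from atoms with this
    property and the opposite value cannot coexist. *)
Lemma detval_consistent n : detval true n -> ~ detval false n.
Proof.
pose P b n := detval b n /\ ~ detval (~~ b) n.
have H b m : detval b m -> P b m.
  move=> d; apply: (d P) => c A hA.
  have hA' : eval (kleene detval) A env0 c by apply: kleene_monotone hA => c' m' [].
  split; first exact/detval_code.
  have K d' : eval (kleene detval) A env0 (~~ d') -> eval (kleene P) A env0 d' -> False.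
    elim: (A) (env0) d' => [s t|t|t|A' IH|A' IHA B IHB|x A' IH] e d' /=.
    - by move=> ->; case: d'.
    - by move=> p [].
    - by case: d' => [[]|_ []].
    - exact: IH.
    - case: d' => /= [[p|p] [q r]|[p q] [r|r]].
      + exact: (IHA e true).
      + exact: (IHB e true).
      + exact: (IHA e false).
      + exact: (IHB e false).
    - case: d' => /= [[n' p] q|p [n' q]].
      + exact: (IH _ true p (q n')).
      + exact: (IH _ false (p n') q).
  by move/detval_code => h; apply: K h hA.
by move/H => [].
Qed.

(** * The models *)

(** The outer truth predicate: the theory of the standard model in which T is
    interpreted by X and D by determinateness. *)
Definition truth (X : nat -> Prop) (n : nat) : Prop :=
  exists2 A, code A = n & sat X det A env0.

Lemma truth_code X A : truth X (code A) <-> sat X det A env0.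
Proof. by split=> [[B /code_inj -> //]|h]; exists A. Qed.

(** The only constraint on the inner truth predicate X. *)
Definition respects (X : nat -> Prop) : Prop := forall b n, detval b n -> (X n <-> b).

(** Determinate values are classical truth values. *)
Lemma kleene_sat X A e b :
  respects X -> eval (kleene detval) A e b -> (sat X det A e <-> b).
Proof.
move=> hX; elim: A e b => [s t|t|t|A IH|A IHA B IHB|x A IH] e b /=.
- by move=> <-.
- exact: hX.
- by case=> -> [c d]; split=> // _; exists c.
- by move=> /IH ->; case: b; split=> //; apply.
- case: b => [[/IHA -> /IHB ->] //|[/IHA|/IHB] ->]; by split=> // -[].
- case: b => [h|[n /IH h]]; first by split=> // _ n; apply/(IH _ _ (h n)).
  by split=> // /(_ n) /h.
Qed.

Lemma detval_truth X b A : respects X -> detval b (code A) -> (truth X (code A) <-> b).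
Proof. by move=> hX /detval_code h; rewrite truth_code; apply: kleene_sat. Qed.

(** The form in which the axioms for D express that A is determinate and
    false. *)
Lemma det_false X A : respects X ->
  det (code A) /\ ~ sat X det A env0 <-> eval (kleene detval) A env0 false.
Proof.
move=> hX; split=> [[[b d] ns]|h].
  move: (d) => /detval_code; case: b d => // d h; case: ns.
  by apply/(kleene_sat hX h).
by split; [apply/det_code; exists false | move/(kleene_sat hX h)].
Qed.

Lemma eval_subst_closed S A t x : closedt t ->
  eval S (subst x t A) env0 = eval S A (upd env0 x (val env0 t)).
Proof. by move=> ct; rewrite eval_subst // freefor_closed. Qed.

Lemma eval_subst_numeral S A n x :
  eval S (subst x (numeral n) A) env0 = eval S A (upd env0 x n).
Proof. by rewrite eval_subst_closed ?val_numeral //; apply: closedt_numeral. Qed.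

Lemma ClTermCode_codet t : closedt t -> ClTermCode (codet t).
Proof. by move=> ct; apply/ClTermCodeP; exists t. Qed.

(** The axioms for T are the clauses of satisfaction; T2+ holds because both
    levels of T see the same D, T3 because on determinate sentences X and outer
    truth agree with the determinate value.  The axioms for D are the fixed point
    equation of [detval].  The numerals serve as closed terms denoting all
    numbers, and regularity is the substitution lemma. *)
Lemma CDplus_sound X A : respects X -> CDplus A -> forall e, sat (truth X) det A e.
Proof.
move=> hX; case=> {A} [A /PA_axiom_sound pa||||||||||||||] e; [exact: pa|..]; by_den.
- move=> _ /ClTermCodeP [s cs <-] _ /ClTermCodeP [t ct <-].
  rewrite (truth_code _ (fEq s t)) /=; split=> [/eqP E|[y []]].
    by exists (val env0 s); rewrite !ValCode_codet.
  by rewrite !ValCode_codet // => -> ->.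
- move=> _ /ClTermCodeP [t ct <-]; rewrite (truth_code _ (fDet t)) /=.
  split=> [[y []]|d]; first by rewrite ValCode_codet // => ->.
  by exists (val env0 t); rewrite ValCode_codet.
- move=> _ /ClTermCodeP [t ct <-] [y []]; rewrite ValCode_codet // => -> [b d].
  rewrite (truth_code _ (fTr t)) /= (hX _ _ d).
  have [A EA _] := detval_elim d; rewrite -EA in d *.
  split=> [bt|[z []]].
    by exists (code A); rewrite ValCode_codet //; split=> //; apply/(detval_truth hX d).
  by rewrite ValCode_codet // => ->; rewrite -EA => /(detval_truth hX d).
- move=> _ /SentCode_code [A <-].
  by rewrite (truth_code _ (fNeg A)) truth_code.
- move=> _ /SentCode_code [A <-] _ /SentCode_code [B <-].
  by rewrite (truth_code _ (fConj A B)) !truth_code.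
- move=> _ [x ->] _ /Form1Code_code [A <-].
  rewrite (truth_code _ (fAll x A)) /=; split=> [h _ /ClTermCodeP [t ct <-]|h n].
    by rewrite subst_code_code truth_code eval_subst_closed.
  have := h _ (ClTermCode_codet (@closedt_numeral n)).
  by rewrite subst_code_code => /truth_code; rewrite eval_subst_numeral.
- move=> _ /ClTermCodeP [s cs <-] _ /ClTermCodeP [t ct <-].
  by apply/(det_code (fEq s t)); exists (val env0 s == val env0 t).
- move=> _ /ClTermCodeP [t ct <-]; rewrite (det_code (fTr t)) /=.
  split=> [[b d]|[y []]].
    by exists (val env0 t); rewrite ValCode_codet //; split=> //; exists b.
  by rewrite ValCode_codet // => -> [b d]; exists b.
- move=> _ /ClTermCodeP [t ct <-]; rewrite (det_code (fDet t)) /=.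
  split=> [[b [_ d]]|[y []]].
    by exists (val env0 t); rewrite ValCode_codet.
  by rewrite ValCode_codet // => -> d; exists true.
- move=> _ /SentCode_code [A <-]; rewrite (det_code (fNeg A)) det_code /=.
  by split=> -[b h]; exists (~~ b); rewrite ?negbK.
- move=> _ /SentCode_code [A <-] _ /SentCode_code [B <-].
  rewrite (det_code (fConj A B)) (truth_code _ (fNeg A)) (truth_code _ (fNeg B)) /=.
  rewrite !(det_false _ hX).
  split=> [[[] /=]|].
  + by move=> [a b]; left; split; apply/det_code; exists true.
  + by case; [right; left | right; right].
  + case=> [[/det_code [[] a] /det_code [[] b]]|[a|b]].
    * by exists true.
    * by exists false; right.
    * by exists false; left.
    * by exists false; left.
    * by exists false; left.
    * by exists false; right.
- move=> _ [x ->] _ /Form1Code_code [A <-].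
  rewrite (det_code (fAll x A)) /=; split=> [[[] /= h]|[h|]].
  + left=> _ /ClTermCodeP [t ct <-]; rewrite subst_code_code; apply/det_code; exists true.
    by rewrite eval_subst_closed.
  + case: h => n h; right; exists (codet (numeral n)); split.
      by apply: ClTermCode_codet; apply: closedt_numeral.
    rewrite subst_code_code (truth_code _ (fNeg _)) /= (det_false _ hX).
    by rewrite eval_subst_numeral.
  + have dn n : exists b, eval (kleene detval) A (upd env0 x n) b.
      have := h _ (ClTermCode_codet (@closedt_numeral n)).
      by rewrite subst_code_code => /det_code [b]; rewrite eval_subst_numeral; exists b.
    case: (pselect (exists n, eval (kleene detval) A (upd env0 x n) false)) => [hf|hn].
      by exists false.
    exists true => n; have [[//|b]] := dn n.
    by case: hn; exists n.
  + case=> _ [/ClTermCodeP [t ct <-]].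
    rewrite subst_code_code (truth_code _ (fNeg _)) /= (det_false _ hX).
    by rewrite eval_subst_closed // => hf; exists false; exists (val env0 t).
- move=> _ [x ->] _ /Form1Code_code [A <-] _ /ClTermCodeP [s cs <-] _ /ClTermCodeP [t ct <-].
  case=> y []; rewrite !ValCode_codet // => -> E.
  by rewrite !subst_code_code !truth_code !eval_subst_closed // E.
- move=> _ [x ->] _ /Form1Code_code [A <-] _ /ClTermCodeP [s cs <-] _ /ClTermCodeP [t ct <-].
  case=> y []; rewrite !ValCode_codet // => -> E.
  by rewrite !subst_code_code !det_code !eval_subst_closed // E.
Qed.

(** * Independence *)

(** The determinately true sentences, and one number c more.  If c is not
    determinate this respects the determinate values, and c is the only such
    number declared true. *)
Definition addTrue (c n : nat) : Prop := detval true n \/ n = c.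

Lemma addTrue_respects c : ~ det c -> respects (addTrue c).
Proof.
move=> nc b n d; split=> [[d'|E]|bt]; last by left; rewrite -bt.
  by case: b d => // /(detval_consistent d').
by case: nc; exists b; rewrite -E.
Qed.

Lemma not_derivable c P Q : ~ det c ->
  den (truth (addTrue c)) det 0 env0 P Q -> ~ Q -> ~ derivable CDplus (P 0).
Proof.
move=> nc dPQ nQ /soundness pf; apply/nQ/(den_sat dPQ env0)/pf => B cB.
exact: CDplus_sound (addTrue_respects nc) cB.
Qed.

Notation tr0 := (fTr tZero).

(** The sentence T(0) is not determinate because 0 is no code, and its
    indeterminacy is inherited by the compounds below. *)
Lemma det_0 : ~ det 0.
Proof. by case=> b /detval_elim [A E]; have := code_gt0 A; rewrite E. Qed.

Lemma det_tr0 : ~ det (code tr0).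
Proof. by case/det_code=> b h; apply: det_0; exists b. Qed.

Lemma det_neg A : ~ det (code A) -> ~ det (code (fNeg A)).
Proof. by move=> nA /det_code [b h]; apply: nA; apply/det_code; exists (~~ b). Qed.

Lemma det_conj A : ~ det (code A) -> ~ det (code (fConj A A)).
Proof.
move=> nA /det_code [b h]; apply: nA; apply/det_code; exists b.
by case: b h => /=; [case | case].
Qed.

Lemma det_all A x : ~ free x A -> ~ det (code A) -> ~ det (code (fAll x A)).
Proof.
move=> nf nA /det_code [b h]; apply: nA; apply/det_code; exists b.
have E n : eval (kleene detval) A (upd env0 x n) = eval (kleene detval) A env0.
  by apply: eval_ext => y fy; rewrite /upd; case: eqP fy nf => // ->.
by case: b h => /= [/(_ 0)|[n]]; rewrite E.
Qed.

Lemma addTrue_code c A : ~ det (code A) -> addTrue c (code A) <-> code A = c.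
Proof.
by move=> nA; split=> [[d|//]|]; [case: nA; exists true | right].
Qed.

Lemma truth_trNum X A :
  truth X (pr tagTr (codet (numeral (code A)))) <-> X (code A).
Proof. by rewrite (truth_code _ (fTr (numeral _))) /= val_numeral. Qed.

Lemma truth_faNum X A :
  truth X (pr tagTr (pr (tag1 NegF) (codet (numeral (code A))))) <-> X (code (fNeg A)).
Proof. by rewrite (truth_code _ (fTr (tFun1 NegF (numeral _)))) /= val_numeral. Qed.

Lemma subst_code_tr0 t v : subst_code (code tr0) t v = code tr0.
Proof. by rewrite [LHS]subst_code_unary ?subst_code_zero. Qed.

(** The formulas coded by [allTrInst] and [exFaInst], with C in place of the
    formula defining closed terms. *)
Definition instance (x v : nat) : term := tSub (numeral x) (tVar 0) (numeral v).

Definition allTr (C : form) (x v : nat) : form :=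
  fAll 0 (fImp C (fTr (instance x v))).

Definition exFa (C : form) (x v : nat) : form :=
  fNeg (fAll 0 (fNeg (fConj C (fTr (tFun1 NegF (instance x v)))))).

Lemma tden_eq k e t m n : tden k e t m -> m = n -> tden k e t n.
Proof. by move=> H <-. Qed.

Lemma tden_allTr k e C s t m n : tden k e s m -> tden k e t n ->
  tden k e
    (tFun2 AllF (cVar tZero) (tFun1 NegF (tFun2 ConjF (numeral (code C))
       (tFun1 NegF (tFun1 TrF (cSub0 s t))))))
    (code (allTr C m n)).
Proof.
by move=> Hs Ht; apply: tden_eq; first (rewrite /cSub0; tden_tac).
Qed.

Lemma tden_exFa k e C s t m n : tden k e s m -> tden k e t n ->
  tden k e
    (tFun1 NegF (tFun2 AllF (cVar tZero) (tFun1 NegF (tFun2 ConjF (numeral (code C))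
       (tFun1 TrF (cFun1 NegF (cSub0 s t)))))))
    (code (exFa C m n)).
Proof.
by move=> Hs Ht; apply: tden_eq; first (rewrite /cSub0; tden_tac).
Qed.

(** The existential quantifier hides the formula defining closed terms, whose code
    is too large to be exposed to unification. *)
Lemma tden_quantInst : exists C,
  (forall k e s t m n, tden k e s m -> tden k e t n ->
     tden k e (allTrInst s t) (code (allTr C m n))) /\
  (forall k e s t m n, tden k e s m -> tden k e t n ->
     tden k e (exFaInst s t) (code (exFa C m n))).
Proof.
by exists (pClTerm (tVar 0) 1); split=> *; [apply: tden_allTr | apply: tden_exFa].
Qed.

Ltac tden_base ::=
  match goal with
  | H : _ |- tden _ _ (allTrInst _ _) _ => eapply H; tden_tac
  | H : _ |- tden _ _ (exFaInst _ _) _ => eapply H; tden_tac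
  end.

Ltac den_sentence := rewrite /TTt /TTTt /TTs /TFs /trNum /faNum; den_tac.

Theorem mainTheorem6 :
  (* (i) *)
  (~ derivable CDplus ((∀ t ∈ pClTerm, TTTt t ⇒ TTt t) 0)) /\
  (* (ii) *)
  (~ derivable CDplus ((∀ t ∈ pClTerm, TTt t ⇒ TTTt t) 0)) /\
  (* (iii) *)
  (~ derivable CDplus
     ((∀ x ∈ pSent LT, TTs x ⇔ TTs (tFun1 NegF (tFun1 NegF x))) 0)) /\
  (* (iv) *)
  (~ derivable CDplus
     ((∀ x ∈ pSent LT, ∀ y ∈ pSent LT,
         TTs (tFun2 ConjF x y) ⇔ (TTs x ∧ TTs y)) 0)) /\
  (* (v) *)
  (~ derivable CDplus
     ((∀ x ∈ pSent LT, ∀ y ∈ pSent LT,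
         TFs (tFun2 ConjF x y) ⇔ (TFs x ∨ TFs y)) 0)) /\
  (* (vi) *)
  (~ derivable CDplus
     ((∀ v ∈ pVar, ∀ x ∈ pForm1 LT v,
         TTs (tFun2 AllF v x) ⇔ pTr (allTrInst x v)) 0)) /\
  (* (vii) *)
  (~ derivable CDplus
     ((∀ v ∈ pVar, ∀ x ∈ pForm1 LT v,
         TFs (tFun2 AllF v x) ⇔ pTr (exFaInst x v)) 0)).
Proof.
have neq0 A : code A <> 0 by move=> E; have := code_gt0 A; rewrite E.
(* A variable in place of T(0), so that its code is not computed. *)
have [A EA] : exists A, A = tr0 by exists tr0.
have [sA fA nA] : [/\ SentCode LT (code A), forall v, Form1Code LT v (code A)
    & ~ det (code A)].
  by rewrite EA; split; [exact: SentCode_tr0 | exact: Form1Code_tr0 | exact: det_tr0].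
have [C [denAll denEx]] := tden_quantInst.
have subA t v : subst_code (code A) t v = code A by rewrite EA subst_code_tr0.
split; [|split; [|split; [|split; [|split; [|split]]]]].
(* With t the term 0: T(0) is in X, but is false outside as 0 is not in X. *)
- apply: (@not_derivable (code tr0) _ _ det_tr0); first by den_sentence.
  move=> /(_ _ (ClTermCode_codet (t:=tZero) _)) H.
  have /(truth_code _ tr0) : truth (addTrue (code tr0)) (code tr0).
    by apply: H => //; apply/(truth_trNum _ tr0); right.
  by case=> [d|/esym/neq0 //]; apply: det_0; exists true.
(* With t the term 0: T(0) is true outside as 0 is in X, but is not in X. *)
- apply: (@not_derivable 0 _ _ det_0); first by den_sentence.
  move=> /(_ _ (ClTermCode_codet (t:=tZero) _)) H.
  have /(truth_trNum _ tr0)/(addTrue_code _ det_tr0)/neq0 // :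
    truth (addTrue 0) (pr tagTr (codet (numeral (code tr0)))).
  by apply: H => //; apply/(truth_code _ tr0); right.
- apply: (@not_derivable (code A) _ _ nA); first by den_sentence.
  move=> /(_ _ sA) /=.
  rewrite (truth_trNum _ A) (truth_trNum _ (fNeg (fNeg A))).
  rewrite (addTrue_code _ nA) (addTrue_code _ (det_neg (det_neg nA))).
  by case=> /(_ erefl) /code_inj E _; move: E; rewrite EA.
- apply: (@not_derivable (code A) _ _ nA); first by den_sentence.
  move=> /(_ _ sA _ sA) /=.
  rewrite (truth_trNum _ A) (truth_trNum _ (fConj A A)).
  rewrite (addTrue_code _ nA) (addTrue_code _ (det_conj nA)).
  by case=> _ /(_ (conj erefl erefl)) /code_inj; rewrite EA.
- have nc := det_neg (det_conj nA).
  apply: (@not_derivable _ _ _ nc); first by den_sentence.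
  move=> /(_ _ sA _ sA) /=.
  rewrite (truth_faNum _ A) (truth_faNum _ (fConj A A)).
  rewrite (addTrue_code _ (det_neg nA)) (addTrue_code _ nc).
  by case=> /(_ erefl) [] /code_inj E _; move: E; rewrite EA.
(* All instances of T(0), which is closed, are in X, but forall v, T(0) is not. *)
- have nall : ~ det (code (fAll 0 A)) by apply: det_all nA; rewrite EA.
  apply: (@not_derivable (code A) _ _ nA); first by den_sentence.
  move=> /(_ _ (ex_intro _ 0 erefl) _ (fA _)) /=.
  rewrite (truth_trNum _ (fAll 0 A)) (addTrue_code _ nall) truth_code.
  case=> _ H; have /H/code_inj : sat (addTrue (code A)) det
      (allTr C (code A) (codet (tVar 0))) env0.
    move=> n; apply/sat_imp => _; rewrite /= !val_numeral subA.
    by right.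
  by rewrite EA.
(* The formula ~ forall v, T(0) is in X, but no ~ T(0) for an instance is. *)
- have nall : ~ det (code (fNeg (fAll 0 A))).
    by apply: det_neg; apply: det_all nA; rewrite EA.
  apply: (@not_derivable _ _ _ nall); first by den_sentence.
  move=> /(_ _ (ex_intro _ 0 erefl) _ (fA _)) /=.
  rewrite (truth_faNum _ (fAll 0 A)) (addTrue_code _ nall) truth_code.
  case=> /(_ erefl) H _; apply: H => n [_].
  rewrite /= !val_numeral subA => /(addTrue_code _ (det_neg nA)) /code_inj.
  by rewrite EA.
Qed.
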